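(* Let $S=\begin{pmatrix}a&b\\c&d\end{pmatrix}\in\operatorname{Sp}(2,\mathbb{R})$ with $b\ne0$, and let $f:\mathbb{R}\to\mathbb{C}$ be a (measurable) function satisfying $$|f(x)|\le C_1e^{-\alpha x^2},\qquad |\widehat f_S(\xi)|\le C_2e^{-\beta\xi^2}\qquad (x,\xi\in\mathbb{R})$$ for some $C_1,C_2,\alpha,\beta>0$. (a) If $\alpha\beta=\frac{\pi^2}{b^2}$, then there exists $A\in\mathbb{C}$ such that $f(x)=A\,e^{-(\alpha+i\pi a/b)x^2}$. (b) If $\alpha\beta>\frac{\pi^2}{b^2}$, then $f\equiv0$.
   Context: $\operatorname{Sp}(2,\mathbb{R})$ is the group of real $2\times2$ matrices with determinant $1$. The linear canonical transform (LCT) of $f$ associated with $S$ ($b\neq0$) is $$\widehat f_S(\xi)=(\mathcal{L}_Sf)(\xi)=\frac{1}{\sqrt{ib}}\int_{\mathbb{R}}f(x)\,e^{\frac{i\pi}{b}(d\xi^2+ax^2-2x\xi)}\,dx$$ (the choice of square root affects only a unimodular factor). Functions are identified when equal almost everywhere, so the conclusions about $f$ are understood almost everywhere (everywhere if $f$ is continuous). *)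

(* Defs.v *)
From HB Require Import structures.
From mathcomp Require Import all_boot all_order all_algebra.
From mathcomp Require Import complex.
From mathcomp Require Import all_classical all_reals all_analysis.

Set Implicit Arguments.
Unset Strict Implicit.
Unset Printing Implicit Defensive.

Import Order.TTheory GRing.Theory Num.Theory.
Import numFieldNormedType.Exports.

Local Open Scope ring_scope.
Local Open Scope classical_set_scope.

Definition cexp (R : realType) (z : R[i]) : R[i] :=
  Complex (expR (complex.Re z) * cos (complex.Im z))
          (expR (complex.Re z) * sin (complex.Im z)).

(* Borel measurability; as functions are identified when equal almost everywhere,
   every Lebesgue measurable function has such a representative. *)
Definition cmeasurable (R : realType) (f : R -> R[i]) : Prop :=
  measurable_fun setT (fun x => complex.Re (f x)) /\
  measurable_fun setT (fun x => complex.Im (f x)).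

(* The type ascription selects the topology that the norm of [R[i]] induces. *)
Definition ccontinuous (R : realType) (f : R -> R[i]) : Prop :=
  continuous (f : R -> (R[i] : numFieldType)^o).

(* Only meaningful when the real and imaginary parts of [f] are integrable:
   [Rintegral] returns a junk real value otherwise. *)
Definition cintegral (R : realType) (f : R -> R[i]) : R[i] :=
  Complex (\int[@lebesgue_measure R]_x complex.Re (f x))
          (\int[@lebesgue_measure R]_x complex.Im (f x)).

(* For S = [a b; c d] we have a = S 0 0, b = S 0 1, c = S 1 0, d = S 1 1.
   [sqrtC] is the square root with argument in [0, pi[; the other choice
   multiplies the transform by -1. *)
Definition LCT (R : realType) (S : 'M[R]_2) (f : R -> R[i]) (xi : R) : R[i] :=
  (sqrtC ('i * (S 0 1)%:C%C))^-1 *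
  cintegral (fun x => f x *
    cexp ('i * (pi / S 0 1 *
      (S 1 1 * xi ^+ 2 + S 0 0 * x ^+ 2 - 2 * x * xi))%:C%C)).

(* Main.v *)
(* Multiplying f by the chirp exp(i pi a x^2 / b) turns the transform into a
   Fourier transform, and the statement into Hardy's uncertainty principle.  For
   h with |h(x)| <= C exp(-alpha x^2) put A = 1 / (4 alpha) and let L(z) be the
   integral of h(x) exp(x z).  Then H(z) = exp(-A z^2) L(z) satisfies
   |H(x + i y)| <= M exp(A y^2) on the plane and |H| <= M on the imaginary axis,
   so H is bounded by Phragmen-Lindelof and constant by Liouville: h and a
   multiple of exp(-alpha x^2) have the same Laplace transform.

   Neither theorem needs contour integrals.  Having a second order complex
   Taylor expansion at every point is enough for a maximum principle for
   |F| exp(-phi) with phi strictly superharmonic, and both theorems follow from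
   it with explicit phi.  Injectivity of the Laplace transform on functions with
   Gaussian decay: all moments vanish, hence all integrals against trigonometric
   polynomials, hence, by approximating indicator functions of half-lines, the
   integral over every half-line. *)
Require Import Defs.
From HB Require Import structures.
From mathcomp Require Import all_boot all_order all_algebra.
From mathcomp Require Import complex.
From mathcomp Require Import all_classical all_reals all_analysis.
From mathcomp Require Import measurable_realfun.
From mathcomp Require Import ring lra.

Set Implicit Arguments.
Unset Strict Implicit.
Unset Printing Implicit Defensive.

Import Order.TTheory GRing.Theory Num.Theory.
Import numFieldNormedType.Exports.

Local Open Scope ring_scope.
Local Open Scope classical_set_scope.

Import Normc.

(** The obstacle is that the bounds on H are critical: a quadrant has opening pi/2, for which order
    2 is exactly the limiting order of growth, and A y^2 is subharmonic, so it cannot serve as a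
    comparison function. What saves the argument is the shape of the bound. On the ray y = delta x
    the exponent A y^2 equals A delta x y, which is harmonic and vanishes on the imaginary axis. The
    sector delta x <= y, x >= 0 is narrower than a quadrant, so there order 2 is subcritical and |H|
    <= M exp(A delta x y); at a fixed point delta then tends to 0. The usual auxiliary function in
    such a sector is a complex power of exponent above 2. Here it is e w ln w with w a real
    quadratic polynomial: it still outgrows A |z|^2, and its superharmonicity is an elementary
    inequality. In the supercritical case the decay on the imaginary axis is strictly faster than
    needed, so the constant H tends to 0 along it and is 0. *)

(** * Second order Taylor remainders *)

Section TaylorRemainders.
Context {R : realType}.
Implicit Types (x y : R) (c : nat -> R).

Lemma series_exp_coeff_le x n : 0 <= x -> series (exp_coeff x) n <= expR x.
Proof.
move=> x0; apply: nondecreasing_cvgn_le; last exact: is_cvg_series_exp_coeff.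
apply/nondecreasing_seqP => k; rewrite /series/= big_nat_recr//= lerDl.
exact: exp_coeff_ge0.
Qed.

Lemma series_dominated_le x c n : (forall k, `|c k| <= exp_coeff `|x| k) ->
  `|series c n| <= expR `|x|.
Proof.
move=> cx; apply: le_trans (series_exp_coeff_le n (normr_ge0 x)).
by rewrite /series/=; apply: le_trans (ler_norm_sum _ _ _) _; exact: ler_sum.
Qed.

Lemma exp_coeffD_le x m k : 0 <= x ->
  exp_coeff x (m + k) <= x ^+ m * exp_coeff x k.
Proof.
move=> x0; rewrite /exp_coeff/= exprD -mulrA ler_wpM2l ?exprn_ge0//.
rewrite ler_wpM2l ?exprn_ge0// lef_pV2 ?posrE ?ltr0n ?fact_gt0//.
by rewrite ler_nat leq_fact // leq_addl.
Qed.

(** Shared by exp, cos and sin, whose coefficients are all dominated by those of exp. Since k! <= (m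
    + k)!, the factor |x|^m comes out of the tail and leaves a partial sum of the exponential
    series; the bound then passes to the limit. *)
Lemma series_dominated_tail x c l m :
    (forall k, `|c k| <= exp_coeff `|x| k) -> series c @ \oo --> l ->
  `|l - series c m| <= `|x| ^+ m * expR `|x|.
Proof.
move=> cx cl.
have cvgd : (fun n => `|series c n - series c m|) @ \oo --> `|l - series c m|.
  by apply: cvg_norm; apply: cvgB => //; exact: cvg_cst.
apply: (cvgr_to_le cvgd); exists m => // n /= mn.
rewrite sub_series_geq//; apply: le_trans (ler_norm_sum _ _ _) _.
apply: (@le_trans _ _ (`|x| ^+ m * series (exp_coeff `|x|) (n - m)%N)).
  rewrite -{1}(add0n m) big_addn /series/= mulr_sumr.
  apply: ler_sum => i _; apply: le_trans (cx _) _.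
  by rewrite addnC exp_coeffD_le.
by rewrite ler_wpM2l ?exprn_ge0// series_exp_coeff_le.
Qed.

Lemma norm_cos_coeff_le x k : `|cos_coeff x k| <= exp_coeff `|x| k.
Proof.
rewrite /cos_coeff/exp_coeff/= !normrM normfV normrX (ger0_norm (ler0n _ _)).
rewrite normrX normrN1 expr1n mulr1 [`|k`!%:R|]ger0_norm//.
by case: (odd k); rewrite ?mul0r ?mul1r// divr_ge0// exprn_ge0.
Qed.

Lemma norm_sin_coeff_le x k : `|sin_coeff x k| <= exp_coeff `|x| k.
Proof.
rewrite /sin_coeff/exp_coeff/= !normrM normfV normrX (ger0_norm (ler0n _ _)).
rewrite normrX normrN1 expr1n mulr1 [`|k`!%:R|]ger0_norm//.
by case: (odd k); rewrite ?mul0r ?mul1r// divr_ge0// exprn_ge0.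
Qed.

Lemma cvg_series_cos_coeff x : series (cos_coeff x) @ \oo --> cos x.
Proof. by rewrite unlock; exact: is_cvg_series_cos_coeff. Qed.

Lemma cvg_series_sin_coeff x : series (sin_coeff x) @ \oo --> sin x.
Proof. by rewrite unlock; exact: is_cvg_series_sin_coeff. Qed.

Lemma expR_taylor2 x :
  `|expR x - (1 + x + x ^+ 2 / 2)| <= `|x| ^+ 3 * expR `|x|.
Proof.
have := @series_dominated_tail x (exp_coeff x) (expR x) 3.
rewrite /series/= !big_nat_recr//= big_geq// /exp_coeff/=.
rewrite add0r expr0 expr1 !divr1 -[2`!]/2%N; apply; last first.
  exact: is_cvg_series_exp_coeff.
by move=> k; rewrite normrM normfV normrX [`|k`!%:R|]ger0_norm.
Qed.

Lemma cos_taylor2 x : `|cos x - (1 - x ^+ 2 / 2)| <= `|x| ^+ 3 * expR `|x|.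
Proof.
have := @series_dominated_tail x (cos_coeff x) (cos x) 3 (@norm_cos_coeff_le x)
  (@cvg_series_cos_coeff x).
rewrite /series/= !big_nat_recr//= big_geq// /cos_coeff/=.
by rewrite add0r expr0z expr1z expr0 !mul0r addr0 divr1 !mul1r mulN1r mulNr.
Qed.

Lemma sin_taylor2 x : `|sin x - x| <= `|x| ^+ 3 * expR `|x|.
Proof.
have := @series_dominated_tail x (sin_coeff x) (sin x) 3 (@norm_sin_coeff_le x)
  (@cvg_series_sin_coeff x).
rewrite /series/= !big_nat_recr//= big_geq// /sin_coeff/=.
by rewrite !mul0r !add0r addr0 divr1 expr0 !mul1r expr1.
Qed.

Lemma taylor2_le_expR x : 0 <= x -> 1 + x + x ^+ 2 / 2 <= expR x.
Proof.
move=> x0; have := series_exp_coeff_le 3 x0.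
rewrite /series/= !big_nat_recr//= big_geq// /exp_coeff/=.
by rewrite add0r expr0 expr1 !divr1 -[2`!]/2%N.
Qed.

End TaylorRemainders.

Section ComplexExponential.
Context {R : realType}.
Local Notation C := R[i].
Implicit Types z w : C.

Lemma normc_ge0 z : 0 <= normc z.
Proof. by case: z => a b; rewrite sqrtr_ge0. Qed.

Lemma normcD_le z w : normc (z + w) <= normc z + normc w.
Proof. exact: le_normcD. Qed.

Lemma normc_opp z : normc (- z) = normc z.
Proof. by case: z => a b /=; rewrite !sqrrN. Qed.

Lemma normcX z n : normc (z ^+ n) = normc z ^+ n.
Proof.
by elim: n => [|n ih]; rewrite ?expr0 ?normc1// !exprS normcM ih.
Qed.

Lemma normc_sqr (a b : R) : normc (Complex a b) ^+ 2 = a ^+ 2 + b ^+ 2.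
Proof. by rewrite /normc sqr_sqrtr// addr_ge0 ?sqr_ge0. Qed.

Lemma normcR (a : R) : normc a%:C%C = `|a|.
Proof. by rewrite /= expr0n/= addr0 sqrtr_sqr. Qed.

Lemma Re_le_normc z : `|complex.Re z| <= normc z.
Proof.
by case: z => a b /=; rewrite -(sqrtr_sqr a) ler_wsqrtr// lerDl sqr_ge0.
Qed.

Lemma Im_le_normc z : `|complex.Im z| <= normc z.
Proof.
by case: z => a b /=; rewrite -(sqrtr_sqr b) ler_wsqrtr// lerDr sqr_ge0.
Qed.

Lemma normc_le_ReIm z : normc z <= `|complex.Re z| + `|complex.Im z|.
Proof.
case: z => a b /=; rewrite -[leRHS]ger0_norm ?addr_ge0// -sqrtr_sqr.
rewrite ler_wsqrtr// sqrrD !real_normK ?num_real//.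
by rewrite lerD2r lerDl mulrn_wge0// mulr_ge0.
Qed.

Lemma cexpD z w : cexp (z + w) = cexp z * cexp w.
Proof.
case: z w => [a b] [c d]; rewrite /cexp/= expRD cosD sinD.
by apply/eqP; rewrite eq_complex/=; apply/andP; split; apply/eqP; ring.
Qed.

Lemma cexp0 : cexp (0 : C) = 1.
Proof. by rewrite /cexp/= expR0 cos0 sin0 mulr0 mulr1. Qed.

Lemma normc_cexp z : normc (cexp z) = expR (complex.Re z).
Proof.
rewrite /cexp/normc !exprMn -mulrDr cos2Dsin2 mulr1 sqrtr_sqr.
by rewrite ger0_norm ?expR_ge0.
Qed.

Lemma cexpR (a : R) : cexp a%:C%C = (expR a)%:C%C.
Proof. by rewrite /cexp/= cos0 sin0 mulr0 mulr1. Qed.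

(** In exp(a) cos b and exp(a) sin b, one factor at a time is replaced by its Taylor polynomial.
    Each part is then a sum of three terms of size at most r^3 E^2 with E = exp r, whence 3 per
    part, 6 in all, and exp(2 r) = E^2. *)
Lemma cexp_taylor2 z :
  normc (cexp z - (1 + z + z ^+ 2 / 2)) <= 6 * normc z ^+ 3 * expR (2 * normc z).
Proof.
set r := normc z.
have r0 : 0 <= r by exact: normc_ge0.
have [ar br] := (Re_le_normc z, Im_le_normc z).
rewrite -/r in ar br.
have bnd (x : R) : `|x| <= r -> `|x| ^+ 3 * expR `|x| <= r ^+ 3 * expR r.
  move=> xr; apply: ler_pM; rewrite ?expR_ge0 ?exprn_ge0 ?ler_expR//.
  by rewrite lerXn2r ?nnegrE.
have := le_trans (sin_taylor2 _) (bnd _ br).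
have := le_trans (cos_taylor2 _) (bnd _ br).
have := le_trans (expR_taylor2 _) (bnd _ ar).
set a := complex.Re z in ar br *; set b := complex.Im z in ar br *.
set p1 := expR a - _; set p2 := cos b - _; set p3 := sin b - _ => h1 h2 h3.
set E := expR r in h1 h2 h3 *.
have E2 : expR (2 * r) = E * E by rewrite -expRD; congr expR; ring.
have tE : 1 + r + r ^+ 2 / 2 <= E by exact: taylor2_le_expR.
have tE' : `|1 + a + a ^+ 2 / 2| <= E.
  apply: le_trans tE; apply: le_trans (ler_normD _ _) _.
  apply: lerD; first by apply: le_trans (ler_normD _ _) _; rewrite normr1 lerD2l.
  by rewrite normrM normrX [`|2^-1|]ger0_norm// ler_wpM2r// lerXn2r ?nnegrE.
have r2 : 0 <= r ^+ 2 by exact: exprn_ge0.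
have r3 : 0 <= r ^+ 3 by exact: exprn_ge0.
have E1 : 1 <= E by lra.
have EE : E <= E * E by rewrite -{1}(mulr1 E) ler_wpM2l// (le_trans ler01).
have a2 : `|a| ^+ 2 <= r ^+ 2 by rewrite lerXn2r ?nnegrE.
have b2 : `|b| ^+ 2 <= r ^+ 2 by rewrite lerXn2r ?nnegrE.
have dRe : `|complex.Re (cexp z - (1 + z + z ^+ 2 / 2))| <=
    3 * (r ^+ 3 * (E * E)).
  have -> : complex.Re (cexp z - (1 + z + z ^+ 2 / 2)) =
      p1 * cos b + (1 + a + a ^+ 2 / 2) * p2 - (a + a ^+ 2 / 2) * (b ^+ 2 / 2).
    rewrite /p1 /p2 /a /b; case: (z) => x y.
    (* With 2 written as the image of a real number, its inverse is also real and the real part of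
       the quotient reduces. *)
    rewrite -[2 : C]/(2%:R) -[2%:R : C](rmorph_nat (real_complex R)).
    rewrite -fmorphV /=.
    by field.
  have q1 : `|p1 * cos b| <= r ^+ 3 * E.
    rewrite normrM -[leRHS]mulr1 ler_pM//.
    by rewrite ler_norml cos_geN1 cos_le1.
  have q2 : `|(1 + a + a ^+ 2 / 2) * p2| <= E * (r ^+ 3 * E).
    by rewrite normrM ler_pM.
  have q3 : `|(a + a ^+ 2 / 2) * (b ^+ 2 / 2)| <= E * r ^+ 3.
    rewrite normrM.
    have q4 : `|a + a ^+ 2 / 2| <= r * E.
      apply: le_trans (ler_normD _ _) _.
      rewrite normrM normrX [`|2^-1|]ger0_norm//; nra.
    have q5 : `|b ^+ 2 / 2| <= r ^+ 2.
      by rewrite normrM normrX [`|2^-1|]ger0_norm//; nra.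
    apply: le_trans (ler_pM _ _ q4 q5) _ => //.
    by rewrite le_eqVlt; apply/orP; left; apply/eqP; ring.
  apply: le_trans (ler_normB _ _) _; apply: le_trans (lerD (ler_normD _ _) (lexx _)) _.
  nra.
have dIm : `|complex.Im (cexp z - (1 + z + z ^+ 2 / 2))| <=
    3 * (r ^+ 3 * (E * E)).
  have -> : complex.Im (cexp z - (1 + z + z ^+ 2 / 2)) =
      p1 * sin b + (1 + a + a ^+ 2 / 2) * p3 + (a ^+ 2 / 2) * b.
    rewrite /p1 /p3 /a /b; case: (z) => x y.
    rewrite -[2 : C]/(2%:R) -[2%:R : C](rmorph_nat (real_complex R)).
    rewrite -fmorphV /=.
    by field.
  have q1 : `|p1 * sin b| <= r ^+ 3 * E.
    rewrite normrM -[leRHS]mulr1 ler_pM//.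
    by rewrite ler_norml sin_geN1 sin_le1.
  have q2 : `|(1 + a + a ^+ 2 / 2) * p3| <= E * (r ^+ 3 * E).
    by rewrite normrM ler_pM.
  have q3 : `|(a ^+ 2 / 2) * b| <= r ^+ 3.
    rewrite normrM [leRHS]exprSr ler_pM// normrM normrX [`|2^-1|]ger0_norm//; lra.
  apply: le_trans (ler_normD _ _) _; apply: le_trans (lerD (ler_normD _ _) (lexx _)) _.
  nra.
rewrite E2; apply: le_trans (normc_le_ReIm _) _.
apply: le_trans (lerD dRe dIm) _.
by rewrite le_eqVlt; apply/orP; left; apply/eqP; ring.
Qed.

End ComplexExponential.

(** * Second order complex Taylor expansions *)

Section SecondOrderTaylor.
Context {R : realType}.
Local Notation C := R[i].
Implicit Types (F G rho sigma : C -> C) (z w h : C) (k : nat).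

(** The relation rho(h) = O(|h|^k) at 0. That [K] is nonnegative follows but is not recorded, hence
    the [|K|] in later bounds. *)
Definition vanishes k rho := exists r K : R, 0 < r /\
  forall h, normc h <= r -> normc (rho h) <= K * normc h ^+ k.

Lemma vanishes_ext k rho sigma : rho =1 sigma -> vanishes k rho ->
  vanishes k sigma.
Proof. by move=> /funext ->. Qed.

Lemma vanishes_cst z : vanishes 0 (fun=> z).
Proof. by exists 1, (normc z); split => // h _; rewrite expr0 mulr1. Qed.

Lemma vanishes_id : vanishes 1 id.
Proof. by exists 1, 1; split => // h _; rewrite mul1r expr1. Qed.

Lemma vanishesD k rho sigma : vanishes k rho -> vanishes k sigma ->
  vanishes k (fun h => rho h + sigma h).
Proof.
move=> [r [K [r0 rK]]] [s [L [s0 sL]]].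
exists (Num.min r s), (K + L); split; first by rewrite lt_min r0.
move=> h; rewrite le_min => /andP[hr hs].
by rewrite mulrDl; apply: le_trans (normcD_le _ _) _; rewrite lerD ?rK ?sL.
Qed.

Lemma vanishesM j k rho sigma : vanishes j rho -> vanishes k sigma ->
  vanishes (j + k) (fun h => rho h * sigma h).
Proof.
move=> [r [K [r0 rK]]] [s [L [s0 sL]]].
exists (Num.min r s), (K * L); split; first by rewrite lt_min r0.
move=> h; rewrite le_min => /andP[hr hs].
by rewrite normcM exprD mulrACA ler_pM ?normc_ge0 ?rK ?sL.
Qed.

Lemma vanishesZ k z rho : vanishes k rho -> vanishes k (fun h => z * rho h).
Proof. exact: (vanishesM (vanishes_cst z)). Qed.

Lemma vanishesX k : vanishes k (fun h => h ^+ k).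
Proof.
elim: k => [|k ih]; first exact: vanishes_cst.
by apply: vanishes_ext (vanishesM vanishes_id ih) => h; rewrite exprS.
Qed.

Lemma vanishesW j k rho : (j <= k)%N -> vanishes k rho -> vanishes j rho.
Proof.
move=> jk [r [K [r0 rK]]]; exists (Num.min r 1), `|K|.
split; first by rewrite lt_min r0 ltr01.
move=> h; rewrite le_min => /andP[/rK hr h1]; apply: le_trans hr _.
apply: le_trans (ler_wpM2r _ (ler_norm K)) _; first by rewrite exprn_ge0 ?normc_ge0.
by rewrite ler_wpM2l// ler_wiXn2l ?normc_ge0.
Qed.

Lemma vanishes_cexp_taylor2 rho : vanishes 1 rho ->
  vanishes 3 (fun h => cexp (rho h) - (1 + rho h + rho h ^+ 2 / 2)).
Proof.
move=> [r [K [r0 rK]]]; exists r, (6 * `|K| ^+ 3 * expR (2 * (`|K| * r))).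
split=> // h hr; apply: le_trans (cexp_taylor2 _) _.
have rhoK : normc (rho h) <= `|K| * normc h.
  by apply: le_trans (rK h hr) _; rewrite expr1 ler_wpM2r ?normc_ge0 ?ler_norm.
have rhoK' : normc (rho h) <= `|K| * r.
  by apply: le_trans rhoK _; rewrite ler_wpM2l.
have -> : 6 * `|K| ^+ 3 * expR (2 * (`|K| * r)) * normc h ^+ 3 =
    6 * (`|K| * normc h) ^+ 3 * expR (2 * (`|K| * r)) by ring.
apply: ler_pM; rewrite ?expR_ge0//.
- by rewrite mulr_ge0 ?exprn_ge0 ?normc_ge0.
- by rewrite ler_wpM2l// lerXn2r ?nnegrE ?mulr_ge0 ?normc_ge0.
- by rewrite ler_expR ler_wpM2l.
Qed.

(** The order of the remainder is dictated by the maximum principle, where it must be negligible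
    against a gain of size |h|^2. Only existence of the coefficients matters, so they are not tied
    to derivatives. *)
Definition taylor2 F z := exists g1 g2 : C,
  vanishes 3 (fun h => F (z + h) - (F z + g1 * h + g2 * h ^+ 2)).

Lemma taylor2_vanishes0 F z : taylor2 F z -> vanishes 0 (fun h => F (z + h)).
Proof.
move=> [g1 [g2 Fz]].
have := vanishesD (vanishesW (leq0n _) Fz) (vanishesD (vanishes_cst (F z))
  (vanishesD (vanishesW (leq0n _) (vanishesZ g1 vanishes_id))
     (vanishesW (leq0n _) (vanishesZ g2 (vanishesX 2))))).
by apply: vanishes_ext => h /=; ring.
Qed.

Lemma taylor2_vanishes1 F z : taylor2 F z ->
  vanishes 1 (fun h => F (z + h) - F z).
Proof.
move=> [g1 [g2 Fz]].
have := vanishesD (vanishesW (isT : (1 <= 3)%N) Fz)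
  (vanishesD (vanishesZ g1 vanishes_id)
     (vanishesW (isT : (1 <= 2)%N) (vanishesZ g2 (vanishesX 2)))).
by apply: vanishes_ext => h /=; ring.
Qed.

Lemma taylor2_cst w z : taylor2 (fun=> w) z.
Proof.
exists 0, 0; apply: vanishes_ext (vanishesZ 0 (vanishesX 3)) => h; ring.
Qed.

Lemma taylor2D F G z : taylor2 F z -> taylor2 G z ->
  taylor2 (fun w => F w + G w) z.
Proof.
move=> [f1 [f2 Fz]] [g1 [g2 Gz]]; exists (f1 + g1), (f2 + g2).
by apply: vanishes_ext (vanishesD Fz Gz) => h; ring.
Qed.

Lemma taylor2M F G z : taylor2 F z -> taylor2 G z ->
  taylor2 (fun w => F w * G w) z.
Proof.
move=> [f1 [f2 Fz]] [g1 [g2 Gz]].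
exists (f1 * G z + F z * g1), (f2 * G z + f1 * g1 + F z * g2).
have G0 : vanishes 0 (fun h => G (z + h)).
  by apply: taylor2_vanishes0; exists g1, g2.
have p0 : vanishes 0 (fun h => F z + f1 * h + f2 * h ^+ 2).
  apply: vanishesD; first apply: vanishesD.
  - exact: vanishes_cst.
  - exact: vanishesW (leq0n _) (vanishesZ f1 vanishes_id).
  - exact: vanishesW (leq0n _) (vanishesZ f2 (vanishesX 2)).
(* With p and q the quadratic polynomials of F and G, this is F G - p q = (F - p) G + p (G - q),
   plus the terms of degree 3 and 4 of p q. *)
have := vanishesD (vanishesM Fz G0) (vanishesD (vanishesM p0 Gz)
  (vanishesD (vanishesZ (f1 * g2 + f2 * g1) (vanishesX 3))
    (vanishesW (isT : (3 <= 4)%N) (vanishesZ (f2 * g2) (vanishesX 4))))).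
by apply: vanishes_ext => h /=; ring.
Qed.

Lemma taylor2X F n z : taylor2 F z -> taylor2 (fun w => F w ^+ n) z.
Proof.
move=> Fz; elim: n => [|n ih].
  by rewrite [X in taylor2 X](_ : _ = fun=> 1); [exact: taylor2_cst|exact/funext].
rewrite [X in taylor2 X](_ : _ = fun w => F w * F w ^+ n); first exact: taylor2M.
by apply/funext => w; rewrite exprS.
Qed.

(** Quadratic exponents cover both uses: the correction factor in [no_interior_max] and the Gaussian
    factor exp(- A z^2) in [hardy_const]. *)
Lemma taylor2_cexp (p q : C) z : taylor2 (fun w => cexp (p * w + q * w ^+ 2)) z.
Proof.
pose a := p + 2 * q * z; pose d h := a * h + q * h ^+ 2.
have d1 : vanishes 1 d.
  apply: vanishesD (vanishesZ a vanishes_id) _.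
  exact: vanishesW (isT : (1 <= 2)%N) (vanishesZ q (vanishesX 2)).
set e := cexp (p * z + q * z ^+ 2).
exists (e * a), (e * (q + a ^+ 2 / 2)).
have := vanishesZ e (vanishesD (vanishes_cexp_taylor2 d1)
  (vanishesD (vanishesZ (a * q) (vanishesX 3))
    (vanishesW (isT : (3 <= 4)%N) (vanishesZ (q ^+ 2 / 2) (vanishesX 4))))).
apply: vanishes_ext => h /=.
have -> : p * (z + h) + q * (z + h) ^+ 2 = p * z + q * z ^+ 2 + d h.
  by rewrite /d /a; ring.
by rewrite [in RHS]cexpD -/e /d; field.
Qed.

(** The remainder is exactly - h^3 / (z^3 (z + h)), and 1 / |z + h| <= 2 / |z| as soon as |h| <= |z|
    / 2. *)
Lemma taylor2_inv z : z != 0 -> taylor2 (fun w => w^-1) z.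
Proof.
move=> z0; exists (- z^-1 ^+ 2), (z^-1 ^+ 3).
have nz : 0 < normc z.
  rewrite lt_def normc_ge0 andbT; apply: contra z0 => /eqP.
  by move=> /eq0_normc ->.
have [r [K [r0 rK]]] : vanishes 0 (fun h => if z + h == 0 then 0 else (z + h)^-1).
  exists (normc z / 2), (2 / normc z); split=> [|h hz]; first by rewrite divr_gt0.
  case: ifPn => _.
    by rewrite normc0 expr0 mulr1 divr_ge0// ltW.
  rewrite normcV expr0 mulr1 -[leRHS]invf_div lef_pV2 ?posrE ?divr_gt0//.
    have := normcD_le (z + h) (- h); rewrite addrK normc_opp; lra.
  have := normcD_le (z + h) (- h); rewrite addrK normc_opp; lra.
have v0 : vanishes 0 (fun h => (z + h)^-1).
  exists r, K; split => // h /rK; case: ifPn => // /eqP ->.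
  by rewrite invr0.
have [s [L [s0 sL]]] := vanishesM (vanishesZ (- z^-1 ^+ 3) (vanishesX 3)) v0.
exists (Num.min s (normc z / 2)), L; split.
  by rewrite lt_min s0 divr_gt0.
move=> h; rewrite le_min => /andP[/sL + hz].
have zh : z + h != 0.
  apply/eqP => zh; have := normcD_le (z + h) (- h).
  by rewrite addrK normc_opp zh normc0; lra.
rewrite addn0; congr (normc _ <= _).
by field; rewrite zh z0.
Qed.

Lemma taylor2_shift F z : taylor2 F z -> taylor2 (fun h => F (z + h)) 0.
Proof.
move=> [g1 [g2 Fz]]; exists g1, g2.
by apply: vanishes_ext Fz => h; rewrite add0r addr0.
Qed.

Lemma taylor2_opp F z : taylor2 F (- z) -> taylor2 (fun w => F (- w)) z.
Proof.
move=> [g1 [g2 [r [K [r0 rK]]]]]; exists (- g1), g2, r, K; split => // h.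
rewrite -(normc_opp h) => /rK; congr (normc _ <= _).
by rewrite (opprD z h); ring.
Qed.

Lemma normc_conj z : normc (z^*)%C = normc z.
Proof. by case: z => a b; rewrite /= sqrrN. Qed.

(** With [taylor2_opp], this lets reflections carry an estimate from one quadrant to the others. *)
Lemma taylor2_conj F z : taylor2 F (z^*)%C ->
  taylor2 (fun w => conjc (F (conjc w))) z.
Proof.
move=> [g1 [g2 [r [K [r0 rK]]]]].
exists (g1^*)%C, (g2^*)%C, r, K; split => // h.
rewrite -(normc_conj h) => /rK; rewrite -[X in X <= _]normc_conj.
congr (normc _ <= _).
by rewrite !rmorphB !rmorphD !rmorphM /= !conjcK.
Qed.

Lemma taylor2_continuous_normc F (p : R * R) : taylor2 F (Complex p.1 p.2) ->
  {for p, continuous (fun q : R * R => normc (F (Complex q.1 q.2)))}.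
Proof.
move=> /taylor2_vanishes1[r [K [r0 rK]]].
apply/cvgrPdist_le => /= e e0.
pose L := `|K| + 1.
have L0 : 0 < L by rewrite ltr_wpDl.
pose t := Num.min r (e / L) / 2.
have t0 : 0 < t by rewrite divr_gt0// lt_min r0 divr_gt0.
exists (ball p.1 t, ball p.2 t); first by split; exact: nbhsx_ballx.
move=> [x y]/= [px py].
pose h := Complex (x - p.1) (y - p.2).
have hE : normc h <= Num.min r (e / L).
  apply: le_trans (normc_le_ReIm _) _ => /=.
  have : `|x - p.1| <= t by rewrite distrC ltW.
  have : `|y - p.2| <= t by rewrite distrC ltW.
  rewrite /t; lra.
move: hE; rewrite le_min => /andP[/rK hr he].
have zh : Complex p.1 p.2 + h = Complex x y.
  by apply/eqP; rewrite eq_complex/= !subrKC !eqxx.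
rewrite zh in hr.
have hL : normc (F (Complex x y) - F (Complex p.1 p.2)) <= e.
  apply: le_trans hr _; rewrite expr1.
  apply: (@le_trans _ _ (L * normc h)).
    by rewrite ler_wpM2r ?normc_ge0// /L (le_trans (ler_norm K))// lerDl.
  by rewrite mulrC -ler_pdivlMr.
rewrite ler_norml; apply/andP; split.
  have := normcD_le (F (Complex x y) - F (Complex p.1 p.2)) (F (Complex p.1 p.2)).
  rewrite subrK; lra.
have := normcD_le (- (F (Complex x y) - F (Complex p.1 p.2))) (F (Complex x y)).
rewrite normc_opp opprB subrK; lra.
Qed.

End SecondOrderTaylor.

(** * Maximum principle *)

Section MaximumPrinciple.
Context {R : realType}.
Local Notation C := R[i].
Implicit Types (F : C -> C) (phi : R * R -> R) (p q : R * R).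

(** For smooth phi this is a negative Laplacian at p: the second order Taylor polynomial is phi(p),
    plus a harmonic part Re(l h + m h^2), plus a quarter of the Laplacian times |h|^2. Only an upper
    bound is required, so phi need not be differentiated. *)
Definition strictly_superharmonic phi p := exists (l m : C) (k K r : R),
  [/\ 0 < k, 0 < r & forall h : C, normc h <= r ->
    phi (p.1 + complex.Re h, p.2 + complex.Im h) <=
    phi p + complex.Re (l * h + m * h ^+ 2) - k * normc h ^+ 2 + K * normc h ^+ 3].

(* Multiplying by the exponential of [- l h - m h ^ 2] removes the first order
   term and the harmonic second order term of [phi]; the mean over the four
   points [h = t, i t, - t, - i t] then kills the terms in [h] and [h ^ 2]. *)
Lemma no_interior_max F phi p :
  taylor2 F (Complex p.1 p.2) -> strictly_superharmonic phi p ->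
  F (Complex p.1 p.2) != 0 ->
  ~ exists2 r : R, 0 < r & forall h : C, normc h <= r ->
    normc (F (Complex p.1 p.2 + h)) *
      expR (- phi (p.1 + complex.Re h, p.2 + complex.Im h)) <=
    normc (F (Complex p.1 p.2)) * expR (- phi p).
Proof.
set z := Complex _ _ => Fz [l [m [k [K [r0 [k0 r00 phiP]]]]]] Fz0 [r1 r10 Fmax].
have [g1 [g2 [r2 [K2 [r20 EP]]]]] :=
  taylor2M (taylor2_shift Fz) (taylor2_cexp (- l) (- m) 0).
set M := normc (F z) in Fmax.
have M0 : 0 < M.
  by rewrite lt_def normc_ge0 andbT; apply: contra Fz0 => /eqP/eq0_normc ->.
(* The bounds on [t] serve three purposes: [tK] lets half of the gain k t^2 absorb K t^3, [tM] makes
   the Taylor remainder at most M s / 4, and [t1] with [tk] gives s <= 1, where s = k t^2 / 2. *)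
near (0 : R)^'+ => t.
have t0 : 0 < t by near: t; exact: nbhs_right_gt.
have tr0 : t <= r0 by near: t; exact: nbhs_right_le.
have tr1 : t <= r1 by near: t; exact: nbhs_right_le.
have tr2 : t <= r2 by near: t; exact: nbhs_right_le.
have t1 : t <= 1 by near: t; exact: nbhs_right_le.
have tk : t <= k^-1 by near: t; apply: nbhs_right_le; rewrite invr_gt0.
have tK : t <= k / (2 * (`|K| + 1)).
  by near: t; apply: nbhs_right_le; rewrite divr_gt0 ?mulr_gt0 ?ltr_wpDl.
have tM : t <= M * k / (8 * (`|K2| + 1)).
  by near: t; apply: nbhs_right_le; rewrite divr_gt0 ?mulr_gt0 ?ltr_wpDl.
pose s := k * t ^+ 2 / 2.
pose E (h : C) := F (z + h) * cexp (- l * h + - m * h ^+ 2).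
have Ebnd h : normc h = t -> normc (E h) <= M * expR (- s).
  move=> ht; rewrite normcM normc_cexp.
  have := Fmax h; rewrite ht => /(_ tr1).
  have := phiP h; rewrite ht => /(_ tr0) h1 h2.
  have h3 : normc (F (z + h)) <=
      M * expR (phi (p.1 + complex.Re h, p.2 + complex.Im h) - phi p).
    move: h2; rewrite expRN ler_pdivrMr ?expR_gt0// => /le_trans; apply.
    by rewrite -mulrA -expRD addrC.
  apply: le_trans (ler_wpM2r (expR_ge0 _) h3) _.
  rewrite -mulrA -expRD ler_wpM2l ?normc_ge0// ler_expR.
  have -> : complex.Re (- l * h + - m * h ^+ 2) = - complex.Re (l * h + m * h ^+ 2).
    by rewrite !mulNr -opprD raddfN.
  have : K * t ^+ 3 <= k * t ^+ 2 / 2.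
    have Kt : K * t <= k / 2.
      set X := k / _ in tK.
      have X0 : 0 <= X by rewrite divr_ge0 ?mulr_ge0 ?ltW// ltr_wpDl.
      have XK : X * (`|K| + 1) = k / 2.
        by rewrite /X; field; rewrite gt_eqF// ltr_wpDl.
      have := ler_wpM2r (ltW t0) (ler_norm K).
      have := ler_wpM2l (normr_ge0 K) tK; lra.
    by have := ler_wpM2l (sqr_ge0 t) Kt; rewrite exprSr; lra.
  rewrite /s; lra.
have Erem h : normc h = t ->
    normc (E h - (E 0 + g1 * h + g2 * h ^+ 2)) <= K2 * t ^+ 3.
  by move=> ht; have := EP h; rewrite ht => /(_ tr2); rewrite /E !add0r.
pose a := t%:C%C : C; pose b := Complex 0 t : C.
have na : normc a = t by rewrite normcR gtr0_norm.
have nb : normc b = t by rewrite /= expr0n/= add0r sqrtr_sqr gtr0_norm.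
have nna : normc (- a) = t by rewrite normc_opp.
have nnb : normc (- b) = t by rewrite normc_opp.
have b2 : b ^+ 2 = - a ^+ 2.
  by apply/eqP; rewrite eq_complex/=; apply/andP; split; apply/eqP; ring.
have E0 : E 0 = F z.
  by rewrite /E expr0n !mulr0 !addr0 cexp0 mulr1.
have mean : 4 * E 0 = (E a + E (- a) + (E b + E (- b))) -
  ((E a - (E 0 + g1 * a + g2 * a ^+ 2)) +
   (E (- a) - (E 0 + g1 * - a + g2 * (- a) ^+ 2)) +
   ((E b - (E 0 + g1 * b + g2 * b ^+ 2)) +
    (E (- b) - (E 0 + g1 * - b + g2 * (- b) ^+ 2)))).
  by rewrite !sqrrN b2; ring.
have : 4 * M <= 4 * (M * expR (- s)) + 4 * (K2 * t ^+ 3).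
  have -> : 4 * M = normc (4 * E 0).
    by rewrite E0 normcM -[4 : C]/(4%:R) -(rmorph_nat (real_complex R)) normcR ger0_norm.
  rewrite mean; apply: le_trans (normcD_le _ _) _; rewrite normc_opp.
  have n4 (x y u v : C) B : normc x <= B -> normc y <= B -> normc u <= B ->
      normc v <= B -> normc (x + y + (u + v)) <= 4 * B.
    move=> *; apply: le_trans (normcD_le _ _) _.
    apply: le_trans (lerD (normcD_le _ _) (normcD_le _ _)) _; lra.
  by apply: lerD; apply: n4; rewrite ?Ebnd ?Erem.
have s0 : 0 < s by rewrite divr_gt0 ?mulr_gt0 ?exprn_gt0.
have s1 : s <= 1.
  have kt1 : k * t <= 1 by rewrite mulrC -ler_pdivlMr// mul1r.
  have := mulr_ile1 (mulr_ge0 (ltW k0) (ltW t0)) (ltW t0) kt1 t1.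
  rewrite /s; lra.
have es : expR (- s) * (1 + s) <= 1.
  rewrite expRN mulrC ler_pdivrMr ?expR_gt0// mul1r; exact: expR_ge1Dx.
have e0 := expR_gt0 (- s).
have K2t : K2 * t <= M * k / 8.
  move: tM; rewrite invfM mulrA ler_pdivlMr ?ltr_wpDl//.
  have := ler_wpM2r (ltW t0) (ler_norm K2); lra.
move=> h4.
have h5 : M <= M * expR (- s) + K2 * t ^+ 3 by lra.
have h6 : K2 * t ^+ 3 <= M * s / 4.
  by have := ler_wpM2r (sqr_ge0 t) K2t; rewrite /s exprS; lra.
(* Incompatible with exp(- s) <= 1 / (1 + s): the product (1 - s / 4) (1 + s) exceeds 1 for 0 < s <=
   1. *)
have h7 : 1 - s / 4 <= expR (- s) by rewrite -(ler_pM2l M0); lra.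
have h8 : 0 <= 1 + s by lra.
have := ler_wpM2r h8 h7.
have : s * s <= s * 1 by rewrite ler_wpM2l// ltW.
lra.
Unshelve. all: by end_near. Qed.

(** By compactness |F| exp(- phi) attains its maximum on D. By [no_interior_max] this happens at a
    zero of F or at a point where the bound is assumed. *)
Lemma maximum_principle F phi (D : set (R * R)) (B : R) : 0 <= B ->
  compact D ->
  (forall p, D p -> taylor2 F (Complex p.1 p.2) /\ {for p, continuous phi}) ->
  (forall p, D p ->
     normc (F (Complex p.1 p.2)) <= B * expR (phi p) \/
     nbhs p D /\ strictly_superharmonic phi p) ->
  forall p, D p -> normc (F (Complex p.1 p.2)) <= B * expR (phi p).
Proof.
move=> B0 cD regD bdD p Dp.
pose v q := normc (F (Complex q.1 q.2)) * expR (- phi q).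
have cv : {within D, continuous v}.
  apply: continuous_in_subspaceT => q /set_mem Dq.
  have [Fq pq] := regD _ Dq.
  apply: (@continuousM _ _ (fun q => normc (F (Complex q.1 q.2)))).
    exact: taylor2_continuous_normc.
  apply: (@continuous_comp _ _ _ (fun q => - phi q) expR).
    exact: continuousN.
  exact: continuous_expR.
have [q /set_mem Dq qmax] := compact_EVT_max (ex_intro _ p Dp) cD cv.
suff : v q <= B.
  move=> vB; have := le_trans (qmax _ (mem_set Dp)) vB.
  by rewrite /v expRN ler_pdivrMr ?expR_gt0.
have [bq|[Dnbh sq]] := bdD _ Dq; first by rewrite /v expRN ler_pdivrMr ?expR_gt0.
have [Fq0|Fq0] := eqVneq (F (Complex q.1 q.2)) 0.
  by rewrite /v Fq0 normc0 mul0r.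
exfalso; apply: (no_interior_max (regD _ Dq).1 sq Fq0).
have [e e0 De] := (nbhs_ballP _ _).1 Dnbh.
exists (e / 2); first by rewrite divr_gt0.
move=> h he.
have /mem_set/qmax : D (q.1 + complex.Re h, q.2 + complex.Im h).
  apply: De; split; rewrite /ball/= opprD addNKr normrN.
    apply: le_lt_trans (Re_le_normc h) _.
    by rewrite (le_lt_trans he)// gtr_pMr// invf_lt1// ltr1n.
  apply: le_lt_trans (Im_le_normc h) _.
  by rewrite (le_lt_trans he)// gtr_pMr// invf_lt1// ltr1n.
rewrite /v/=; congr (normc (F _) * _ <= _).
by case: (h) => u w; apply/eqP; rewrite eq_complex/= !eqxx.
Qed.

End MaximumPrinciple.

(** * Phragmen-Lindelof theorem in a sector *)

Section Sector.
Context {R : realType}.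
Local Notation C := R[i].
Implicit Types (F : C -> C) (p q : R * R) (x y : R).

(** A second order upper bound for w ln w, from ln (1 + d / w) <= d / w. Its quadratic coefficient
    is twice the Taylor one, which the size of ln w in [barrier] can afford. *)
Lemma mul_ln_le (w d : R) : 0 < w -> 0 < w + d ->
  (w + d) * ln (w + d) <= w * ln w + (ln w + 1) * d + d ^+ 2 / w.
Proof.
move=> w0 wd.
have wdE : w + d = w * (1 + d / w) by field; rewrite gt_eqF.
have dw : 0 < 1 + d / w by rewrite -(pmulr_rgt0 _ w0) -wdE.
have -> : ln (w + d) = ln w + ln (1 + d / w) by rewrite wdE lnM.
have : ln (1 + d / w) <= d / w by apply: le_ln1Dx; rewrite -subr_gt0 opprK addrC.
move=> /(ler_wpM2l (ltW wd)) h.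
have -> : w * ln w + (ln w + 1) * d + d ^+ 2 / w =
    (w + d) * ln w + (w + d) * (d / w) by field; rewrite gt_eqF.
by rewrite mulrDr lerD2l.
Qed.

(* The harmonic part [x y + (5 delta / 8) (y ^ 2 - x ^ 2)] is positive in the
   sector [delta x <= y]; [- delta / 8 (x ^ 2 + y ^ 2)] makes the sum strictly
   superharmonic, and the large constant lets this beat the gradient term
   [|grad w| ^ 2 / w] in the Laplacian of [w ln w]. *)
Definition barrier (delta : R) p : R :=
  p.1 * p.2 + delta / 2 * p.2 ^+ 2 - 3 * delta / 4 * p.1 ^+ 2 +
  expR (224 / delta ^+ 2).

(** In the sector x y >= delta x^2, which turns the coefficient - 3 delta / 4 of x^2 into delta /
    4. *)
Lemma barrier_ge delta p : 0 < delta -> 0 <= p.1 -> delta * p.1 <= p.2 ->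
  delta / 4 * (p.1 ^+ 2 + p.2 ^+ 2) + expR (224 / delta ^+ 2) <= barrier delta p.
Proof.
move: p => [x y]/= d0 x0 dxy; rewrite /barrier/= lerD2r.
have h1 : 0 <= x * (y - delta * x) by rewrite mulr_ge0// subr_ge0.
have h2 : 0 <= delta * y ^+ 2 by rewrite mulr_ge0 ?sqr_ge0// ltW.
clear -h1 h2; lra.
Qed.

Lemma barrier_ge1 delta p : 0 < delta -> 0 <= p.1 -> delta * p.1 <= p.2 ->
  1 <= barrier delta p.
Proof.
move=> d0 x0 dxy; apply: le_trans (barrier_ge d0 x0 dxy).
apply: ler_wpDl; first by rewrite mulr_ge0 ?addr_ge0 ?sqr_ge0// divr_ge0// ltW.
by rewrite -expR0 ler_expR divr_ge0// sqr_ge0.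
Qed.

(** The left-hand side is |grad w|^2 for w = [barrier delta]. It is at most 7 (x^2 + y^2), and x^2 +
    y^2 <= 4 w / delta by [barrier_ge], whence 28; the 224 in [barrier] is 8 times 28. *)
Lemma barrier_gradient_le delta p : 0 < delta <= 1 -> 0 <= p.1 ->
  delta * p.1 <= p.2 ->
  (p.2 - 3 * delta / 2 * p.1) ^+ 2 + (p.1 + delta * p.2) ^+ 2 <=
  28 / delta * barrier delta p.
Proof.
move=> /andP[d0 d1] x0 dxy.
have := ler_wpM2l (ltW (divr_gt0 (ltr0n R 28) d0)) (barrier_ge d0 x0 dxy).
move/(le_trans _); apply.
rewrite mulrDr; apply: ler_wpDr.
  by rewrite mulr_ge0 ?expR_ge0 ?divr_ge0// ltW.
have -> : 28 / delta * (delta / 4 * (p.1 ^+ 2 + p.2 ^+ 2)) =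
  7 * (p.1 ^+ 2 + p.2 ^+ 2) by field; rewrite gt_eqF.
move: p x0 dxy => [x y]/= _ _.
have dd : delta ^+ 2 <= 1 by rewrite exprn_ile1// ltW.
have hx : delta ^+ 2 * x ^+ 2 <= 1 * x ^+ 2 by rewrite ler_wpM2r ?sqr_ge0.
have hy : delta ^+ 2 * y ^+ 2 <= 1 * y ^+ 2 by rewrite ler_wpM2r ?sqr_ge0.
have h1 : 0 <= (y + 3 * delta / 2 * x) ^+ 2 by exact: sqr_ge0.
have h2 : 0 <= (x - delta * y) ^+ 2 by exact: sqr_ge0.
have h3 : 0 <= x ^+ 2 by exact: sqr_ge0.
have h4 : 0 <= y ^+ 2 by exact: sqr_ge0.
clear -hx hy h1 h2 h3 h4; lra.
Qed.

Lemma Re_quadratic (u v u' v' : R) (h : C) :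
  complex.Re (Complex u v * h + Complex u' v' * h ^+ 2) =
  u * complex.Re h - v * complex.Im h +
  (u' * (complex.Re h ^+ 2 - complex.Im h ^+ 2) -
   v' * (2 * complex.Re h * complex.Im h)).
Proof. by case: h => s t /=; ring. Qed.

Lemma barrier_superharmonic (a delta e : R) p : 0 < e -> 0 < delta <= 1 ->
  0 <= p.1 -> delta * p.1 <= p.2 ->
  strictly_superharmonic (fun q => a * (q.1 * q.2) +
    e * (barrier delta q * ln (barrier delta q))) p.
Proof.
move=> e0 d01 x0 dxy; have /andP[d0 d1] := d01.
have W1 := barrier_ge1 d0 x0 dxy.
have gradW := barrier_gradient_le d01 x0 dxy.
have WE : expR (224 / delta ^+ 2) <= barrier delta p.
  apply: le_trans (barrier_ge d0 x0 dxy); apply: ler_wpDl => //.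
  by rewrite mulr_ge0 ?addr_ge0 ?sqr_ge0// divr_ge0// ltW.
set W := barrier delta p in W1 gradW WE.
have W0 : 0 < W by exact: lt_le_trans W1.
have lnW : 224 / delta ^+ 2 <= ln W by rewrite -(expRK (224 / _)) ler_ln ?posrE ?expR_gt0.
set l1 := p.2 - _ in gradW; set l2 := p.1 + _ in gradW.
pose L := ln W + 1.
pose N := `|l1| + `|l2|.
have N0 : 0 <= N by rewrite addr_ge0.
(* The linear coefficient is the conjugate of the gradient, since Re ((u + i v) (s + i t)) = u s - v
   t; [L] is the derivative of w ln w, and ([l1], [l2]) is the gradient of w. *)
exists (Complex (a * p.2 + e * L * l1) (- (a * p.1 + e * L * l2))).
exists (Complex (- (5 * delta / 8 * (e * L))) (- ((e * L + a) / 2))).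
(* The radius keeps the increment of w below 1/2, so that w stays positive; 4 N + 4 collects the
   cubic and quartic terms of the squared increment. *)
exists (e * (delta / 8)), (e * (4 * N + 4)), (1 / (2 * (N + 2))).
split; [by rewrite mulr_gt0 ?divr_gt0|by rewrite divr_gt0 ?mulr_gt0 ?ltr_wpDl|].
move=> h hr.
have [sr tr] := (Re_le_normc h, Im_le_normc h).
have h2 : normc h ^+ 2 = complex.Re h ^+ 2 + complex.Im h ^+ 2.
  by case: (h) => u v; rewrite normc_sqr.
have n0 := normc_ge0 h.
rewrite Re_quadratic.
move: (normc h) (complex.Re h) (complex.Im h) hr sr tr h2 n0.
move=> n s t hr sr tr h2 n0.
have hrN : n * (N + 2) <= 1 / 2.
  by move: hr; rewrite invfM mulrA ler_pdivlMr ?ltr_wpDl.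
have n1 : n <= 1 by have := mulr_ge0 n0 N0; lra.
(* As w is a quadratic polynomial, [l] and [q] are its exact linear and quadratic increments. The
   last term of [q] is the superharmonic one. *)
pose l := s * l1 + t * l2.
pose q := s * t - 5 * delta / 8 * (s ^+ 2 - t ^+ 2) - delta / 8 * n ^+ 2.
have Wd : barrier delta (p.1 + s, p.2 + t) = W + (l + q).
  by rewrite /W /barrier /l /q /l1 /l2 h2/=; field.
have lN : `|l| <= n * N.
  apply: le_trans (ler_normD _ _) _; rewrite !normrM /N mulrDr.
  by rewrite lerD// ler_wpM2r.
have s2 : 0 <= s ^+ 2 by exact: sqr_ge0.
have t2 : 0 <= t ^+ 2 by exact: sqr_ge0.
have qn : `|q| <= 2 * n ^+ 2.
  have st1 : 0 <= (s + t) ^+ 2 by exact: sqr_ge0.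
  have st2 : 0 <= (s - t) ^+ 2 by exact: sqr_ge0.
  have ds : delta * s ^+ 2 <= 1 * s ^+ 2 by rewrite ler_wpM2r.
  have dt : delta * t ^+ 2 <= 1 * t ^+ 2 by rewrite ler_wpM2r.
  have ds0 : 0 <= delta * s ^+ 2 by rewrite mulr_ge0// ltW.
  have dt0 : 0 <= delta * t ^+ 2 by rewrite mulr_ge0// ltW.
  rewrite /q h2 ler_norml; clear -s2 t2 st1 st2 ds dt ds0 dt0; apply/andP; split; lra.
have nn : n ^+ 2 <= n by rewrite expr2 ler_piMl.
have lq1 : `|l + q| <= 1 / 2.
  apply: le_trans (ler_normD _ _) _; clear -lN qn nn hrN; lra.
have Wd0 : 0 < W + (l + q).
  move: lq1; rewrite ler_norml => /andP[]; clear -W1; lra.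
have l2n : l ^+ 2 <= (l1 ^+ 2 + l2 ^+ 2) * n ^+ 2.
  have : 0 <= (s * l2 - t * l1) ^+ 2 by exact: sqr_ge0.
  by rewrite h2 /l; clear; lra.
have lqn : (l + q) ^+ 2 <= (l1 ^+ 2 + l2 ^+ 2) * n ^+ 2 + (4 * N + 4) * n ^+ 3.
  have lq : `|l| * `|q| <= (n * N) * (2 * n ^+ 2) by rewrite ler_pM.
  have qq : `|q| * `|q| <= (2 * n ^+ 2) * (2 * n ^+ 2) by rewrite ler_pM.
  have n4 : n ^+ 3 * n <= n ^+ 3 * 1 by rewrite ler_wpM2l// exprn_ge0.
  have h3 : l * q <= `|l| * `|q| by rewrite -normrM ler_norm.
  have h4 : q * q <= `|q| * `|q| by rewrite -normrM ler_norm.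
  clear -lq qq n4 h3 h4 l2n; lra.
have lqW : (l + q) ^+ 2 / W <= 28 / delta * n ^+ 2 + (4 * N + 4) * n ^+ 3.
  rewrite ler_pdivrMr//; apply: le_trans lqn _; rewrite [leRHS]mulrDl; apply: lerD.
    by rewrite [leRHS]mulrAC ler_wpM2r ?sqr_ge0.
  by rewrite ler_peMr// mulr_ge0 ?exprn_ge0 ?addr_ge0 ?mulr_ge0.
(* The superharmonic part of w, multiplied by L, pays for |grad w|^2 / w and leaves a surplus delta
   / 8. This is where the large constant in [barrier] is spent. *)
have L1 : 28 / delta + delta / 8 <= L * (delta / 8).
  have -> : 28 / delta + delta / 8 = (224 / delta ^+ 2 + 1) * (delta / 8).
    by field; rewrite gt_eqF.
  by apply: ler_wpM2r; [rewrite divr_ge0 ?ltW|rewrite /L lerD2r].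
have := mul_ln_le W0 Wd0; rewrite -/L -Wd => hW.
have {}hW : barrier delta (p.1 + s, p.2 + t) *
    ln (barrier delta (p.1 + s, p.2 + t)) <= W * ln W + L * (l + q) +
    (28 / delta * n ^+ 2 + (4 * N + 4) * n ^+ 3).
  by apply: le_trans hW _; rewrite lerD2l.
have {}L1 := ler_wpM2r (sqr_ge0 n) L1.
have {}hW : barrier delta (p.1 + s, p.2 + t) *
    ln (barrier delta (p.1 + s, p.2 + t)) <= W * ln W + (L * (l + q) +
    (L * (delta / 8) - delta / 8) * n ^+ 2 + (4 * N + 4) * n ^+ 3).
  by apply: le_trans hW _; clear -L1; lra.
have {hW} := ler_wpM2l (ltW e0) hW.
rewrite -(lerD2l (a * ((p.1 + s) * (p.2 + t)))) => /le_trans; apply.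
rewrite le_eqVlt; apply/orP; left; apply/eqP.
by rewrite /= -/W /l /q; field.
Qed.

Lemma closed_nonneg (g : R * R -> R) : continuous g -> closed [set p | 0 <= g p].
Proof. by move=> cg; exact: ((continuous_closedP g).1 cg _ (@closed_ge R 0)). Qed.

Lemma continuous_fstR : continuous (fun p : R * R => p.1).
Proof. by move=> p; exact: cvg_fst. Qed.

Lemma continuous_sndR : continuous (fun p : R * R => p.2).
Proof. by move=> p; exact: cvg_snd. Qed.

Lemma continuous_sqnormR : continuous (fun p : R * R => p.1 ^+ 2 + p.2 ^+ 2).
Proof.
move=> p; apply: cvgD; apply: (@cvg_comp _ _ _ _ (fun x : R => x ^+ 2)).
- exact: continuous_fstR.
- exact: exprn_continuous.
- exact: continuous_sndR.
- exact: exprn_continuous.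
Qed.

Lemma compact_in_disc (D : set (R * R)) (rho2 : R) : closed D ->
  (forall p, D p -> p.1 ^+ 2 + p.2 ^+ 2 <= rho2) -> compact D.
Proof.
move=> cD Drho.
have [r0|r0] := leP 0 rho2; last first.
  rewrite (_ : D = set0); first exact: compact0.
  apply/seteqP; split => // p /Drho; have := sqr_ge0 p.1; have := sqr_ge0 p.2.
  by move=> /= *; lra.
have sq x : x ^+ 2 <= rho2 -> - (rho2 + 1) <= x <= rho2 + 1.
  move=> xr; rewrite -ler_norml -(@ler_pXn2r _ 2) ?nnegrE ?addr_ge0//.
  rewrite real_normK ?num_real//; apply: le_trans xr _.
  have := mulr_ge0 r0 r0; rewrite sqrrD expr2; lra.
apply: (subclosed_compact cD (compact_setX (@segment_compact _ (- (rho2 + 1)) (rho2 + 1))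
  (@segment_compact _ (- (rho2 + 1)) (rho2 + 1)))).
move=> p /Drho pr; split => /=; rewrite in_itv/=; apply: sq.
  by apply: le_trans pr; rewrite lerDl sqr_ge0.
by apply: le_trans pr; rewrite lerDr sqr_ge0.
Qed.

(** Comparison with a delta x y + e w ln w: the first term equals a y^2 on the ray y = delta x and 0
    on the imaginary axis, the second dominates a |z|^2 on a large arc, and e then tends to 0. *)
Lemma phragmen_lindelof_sector F (a M delta : R) :
  0 <= a -> 0 <= M -> 0 < delta <= 1 ->
  (forall z, taylor2 F z) ->
  (forall x y, normc (F (Complex x y)) <= M * expR (a * y ^+ 2)) ->
  (forall y, normc (F (Complex 0 y)) <= M) ->
  forall x y, 0 <= x -> delta * x <= y ->
    normc (F (Complex x y)) <= M * expR (a * delta * (x * y)).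
Proof.
move=> a0 M0 d01 TF growth axis x0 y0 x00 dxy0; have /andP[d0 d1] := d01.
pose phi e (q : R * R) :=
  a * delta * (q.1 * q.2) + e * (barrier delta q * ln (barrier delta q)).
suff H e : 0 < e -> normc (F (Complex x0 y0)) <= M * expR (phi e (x0, y0)).
  have cphi : phi e (x0, y0) @[e --> (0 : R)^'+] --> a * delta * (x0 * y0).
    rewrite -[X in _ --> X]addr0; apply: cvgD; first exact: cvg_cst.
    set w := barrier _ _ * _; rewrite -[X in _ --> X](mul0r w).
    by apply: cvgMl; apply: cvg_at_right_filter; exact: cvg_id.
  have : M * expR (phi e (x0, y0)) @[e --> (0 : R)^'+] -->
      M * expR (a * delta * (x0 * y0)).
    by apply: cvgMr; apply: (cvg_comp _ _ cphi); exact: continuous_expR.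
  by move/cvgr_to_ge; apply; near=> e; apply: H; near: e; exact: nbhs_right_gt.
move=> e0.
(* The first two terms put the given point inside the disc. The last one makes w >= delta rho2 / 4
   >= exp(4 a / (e delta)) on the arc, so that e w ln w >= a rho2 >= a y^2 there. *)
pose rho2 := x0 ^+ 2 + y0 ^+ 2 + 4 / delta * expR (4 * a / (e * delta)).
pose D : set (R * R) := [set p | 0 <= p.1] `&` [set p | 0 <= p.2 - delta * p.1] `&`
  [set p | 0 <= rho2 - (p.1 ^+ 2 + p.2 ^+ 2)].
have c2 : continuous (fun p : R * R => p.2 - delta * p.1).
  move=> p; apply: cvgB; first exact: continuous_sndR.
  by apply: cvgMr; exact: continuous_fstR.
have c3 : continuous (fun p : R * R => rho2 - (p.1 ^+ 2 + p.2 ^+ 2)).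
  by move=> p; apply: cvgB; [exact: cvg_cst|exact: continuous_sqnormR].
have cD : compact D.
  apply: (@compact_in_disc _ rho2); last by move=> p [_ /=]; rewrite subr_ge0.
  apply: closedI; first apply: closedI.
  - exact/closed_nonneg/continuous_fstR.
  - exact: closed_nonneg.
  - exact: closed_nonneg.
apply: (@maximum_principle R F (phi e) D M M0 cD) (x0, y0) _; last first.
  split; first by split => //=; rewrite subr_ge0.
  by rewrite /= subr_ge0 /rho2 lerDl mulr_ge0 ?expR_ge0// divr_ge0// ltW.
- move=> p [[/= x1 y1] r1]; rewrite subr_ge0 in y1; rewrite subr_ge0 in r1.
  have W1 := barrier_ge1 d0 x1 y1.
  have phi0 : a * delta * (p.1 * p.2) <= phi e p.
    by rewrite /phi lerDl mulr_ge0 ?(ltW e0)// mulr_ge0 ?ln_ge0// (le_trans ler01).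
  have := x1; rewrite le_eqVlt => /orP[/eqP x1E|x1p].
    left; rewrite -x1E; apply: le_trans (axis _) _.
    rewrite ler_peMr// -expR0 ler_expR; apply: le_trans phi0.
    by rewrite -x1E !(mulr0, mul0r).
  have := y1; rewrite le_eqVlt => /orP[/eqP y1E|y1p].
    left; apply: le_trans (growth _ _) _; rewrite ler_wpM2l// ler_expR.
    by apply: le_trans phi0; rewrite -y1E expr2 !mulrA.
  have := r1; rewrite le_eqVlt => /orP[/eqP r1E|r1p].
    left; apply: le_trans (growth _ _) _; rewrite ler_wpM2l// ler_expR.
    have WB : delta / 4 * rho2 <= barrier delta p.
      apply: le_trans (barrier_ge d0 x1 y1); rewrite r1E.
      by rewrite lerDl expR_ge0.
    have lnW : 4 * a / (e * delta) <= ln (barrier delta p).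
      rewrite -(expRK (4 * a / _)) ler_ln ?posrE ?expR_gt0//; last first.
        exact: lt_le_trans W1.
      apply: le_trans WB; rewrite /rho2 mulrDr; apply: ler_wpDl.
        by rewrite mulr_ge0 ?addr_ge0 ?sqr_ge0// divr_ge0// ltW.
      set E := expR _; suff -> : delta / 4 * (4 / delta * E) = E by [].
      by field; rewrite gt_eqF.
    apply: (@le_trans _ _ (e * (delta / 4 * rho2 * (4 * a / (e * delta))))).
      have -> : e * (delta / 4 * rho2 * (4 * a / (e * delta))) = a * rho2.
        by field; rewrite !gt_eqF.
      by rewrite ler_wpM2l// -r1E lerDr sqr_ge0.
    rewrite /phi; apply: ler_wpDl.
      by rewrite !mulr_ge0// ?(ltW d0)//; apply: le_trans y1; rewrite mulr_ge0// ltW.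
    rewrite ler_wpM2l ?(ltW e0)// ler_pM//.
      by rewrite -r1E mulr_ge0 ?addr_ge0 ?sqr_ge0// divr_ge0// ltW.
    by rewrite divr_ge0 ?mulr_ge0// ltW.
  right; split; last exact: barrier_superharmonic.
  have n1 : \forall q \near p, 0 < q.1 by exact: cvgr_gt (continuous_fstR (x := p)) _ x1p.
  have n2 : \forall q \near p, 0 < q.2 - delta * q.1.
    by apply: cvgr_gt (c2 p) _ _; rewrite subr_gt0.
  have n3 : \forall q \near p, 0 < rho2 - (q.1 ^+ 2 + q.2 ^+ 2).
    by apply: cvgr_gt (c3 p) _ _; rewrite subr_gt0.
  by move: n1 n2 n3; apply: filterS3 => q q1 q2 q3; do ?split; exact: ltW.
- move=> p [[/= x1 y1] r1]; rewrite subr_ge0 in y1.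
  split=> //; apply: cvgD.
    by apply: cvgMr; apply: cvgM; [exact: continuous_fstR|exact: continuous_sndR].
  apply: cvgMr.
  have cb : (barrier delta) @ p --> barrier delta p.
    apply: cvgD; last exact: cvg_cst.
    apply: cvgB; first apply: cvgD.
    - by apply: cvgM; [exact: continuous_fstR|exact: continuous_sndR].
    - apply: cvgMr; apply: (@cvg_comp _ _ _ _ (fun x : R => x ^+ 2)).
        exact: continuous_sndR.
      exact: exprn_continuous.
    - apply: cvgMr; apply: (@cvg_comp _ _ _ _ (fun x : R => x ^+ 2)).
        exact: continuous_fstR.
      exact: exprn_continuous.
  apply: cvgM => //; apply: (@cvg_comp _ _ _ _ (@ln R) _ _ _ cb).
  by apply: continuous_ln; exact: lt_le_trans (barrier_ge1 d0 x1 y1).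
Unshelve. all: by end_near. Qed.

End Sector.

(** * Phragmen-Lindelof and Liouville theorems in the plane *)

Section PhragmenLindelofLiouville.
Context {R : realType}.
Local Notation C := R[i].
Implicit Types (F G : C -> C) (x y : R) (z : C).

Lemma ler_expR_at_right0 (u M c : R) :
  (\forall d \near (0 : R)^'+, u <= M * expR (d * c)) -> u <= M.
Proof.
have cd : d @[d --> (0 : R)^'+] --> (0 : R).
  by apply: cvg_at_right_filter; exact: cvg_id.
have cdc : d * c @[d --> (0 : R)^'+] --> 0 * c by exact: cvgMl.
have cexp : expR (d * c) @[d --> (0 : R)^'+] --> expR (0 * c).
  exact: (cvg_comp _ _ cdc (@continuous_expR R (0 * c))).
have : M * expR (d * c) @[d --> (0 : R)^'+] --> M * expR (0 * c) by exact: cvgMr.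
by rewrite mul0r expR0 mulr1; exact: cvgr_to_ge.
Qed.

(** A point with y > 0 lies in every sector of small enough delta, and the factor exp(a delta x y)
    tends to 1. On the real axis the growth bound already gives M. *)
Lemma phragmen_lindelof_quadrant F (a M : R) : 0 <= a -> 0 <= M ->
  (forall z, taylor2 F z) ->
  (forall x y, normc (F (Complex x y)) <= M * expR (a * y ^+ 2)) ->
  (forall y, normc (F (Complex 0 y)) <= M) ->
  forall x y, 0 <= x -> 0 <= y -> normc (F (Complex x y)) <= M.
Proof.
move=> a0 M0 TF growth axis x y x0; rewrite le_eqVlt => /orP[/eqP <-|y0].
  by apply: le_trans (growth _ _) _; rewrite expr0n mulr0 expR0 mulr1.
have x1 : 0 < x + 1 by rewrite ltr_wpDl.
apply: (@ler_expR_at_right0 _ _ (a * (x * y))); near=> d.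
have d0 : 0 < d by near: d; exact: nbhs_right_gt.
have d1 : d <= 1 by near: d; exact: nbhs_right_le.
rewrite mulrA [d * a]mulrC; apply: phragmen_lindelof_sector => //.
  by rewrite d0.
(* Dividing by x + 1 rather than x also covers x = 0. *)
have : d <= y / (x + 1) by near: d; apply: nbhs_right_le; rewrite divr_gt0.
by rewrite ler_pdivlMr// => /(le_trans _); apply; rewrite ler_wpM2l ?(ltW d0)// lerDl.
Unshelve. all: by end_near. Qed.

(** The hypotheses are invariant under z -> - z and under the reflection in the imaginary axis,
    conjugated to stay holomorphic. The latter gives the upper half-plane, the former the lower
    one. *)
Lemma phragmen_lindelof_plane F (a M : R) : 0 <= a -> 0 <= M ->
  (forall z, taylor2 F z) ->
  (forall x y, normc (F (Complex x y)) <= M * expR (a * y ^+ 2)) ->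
  (forall y, normc (F (Complex 0 y)) <= M) ->
  forall z, normc (F z) <= M.
Proof.
move=> a0 M0 TF growth axis.
have half H : (forall z, taylor2 H z) ->
    (forall x y, normc (H (Complex x y)) <= M * expR (a * y ^+ 2)) ->
    (forall y, normc (H (Complex 0 y)) <= M) ->
    forall x y, 0 <= y -> normc (H (Complex x y)) <= M.
  move=> TH gH aH x y y0; have [x0|x0] := leP 0 x.
    exact: (@phragmen_lindelof_quadrant H a).
  have NJ (u v : R) : - conjc (Complex u v) = Complex (- u) v.
    by apply/eqP; rewrite eq_complex/= opprK !eqxx.
  have : normc (conjc (H (- conjc (Complex (- x) y)))) <= M.
    apply: (@phragmen_lindelof_quadrant (fun z => conjc (H (- conjc z))) a) => //.
    - move=> z; apply: (@taylor2_conj _ (fun w => H (- w))).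
      exact: taylor2_opp.
    - by move=> u v; rewrite normc_conj NJ.
    - by move=> v; rewrite normc_conj NJ oppr0.
    - by rewrite oppr_ge0 ltW.
  by rewrite normc_conj NJ opprK.
have N (u v : R) : - Complex u v = Complex (- u) (- v).
  by apply/eqP; rewrite eq_complex/= !eqxx.
case=> x y; have [y0|y0] := leP 0 y; first exact: half.
have : normc (F (- Complex (- x) (- y))) <= M.
  apply: (half (fun z => F (- z))).
  - by move=> z; exact: taylor2_opp.
  - by move=> u v; rewrite N -(sqrrN v).
  - by move=> v; rewrite N oppr0.
  - by rewrite oppr_ge0 ltW.
by rewrite N !opprK.
Qed.

Lemma bernoulli_le (x : R) n : -1 <= x -> 1 + n%:R * x <= (1 + x) ^+ n.
Proof.
move=> x1; have x10 : 0 <= 1 + x by rewrite -lerBlDl sub0r.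
elim: n => [|n ih]; first by rewrite mul0r addr0 expr0.
rewrite exprS; have := ler_wpM2l x10 ih; apply: le_trans.
have : 0 <= n%:R * x ^+ 2 by rewrite mulr_ge0 ?sqr_ge0.
by rewrite -natr1; clear; lra.
Qed.

Lemma expr_unbounded (t B : R) : 1 < t -> exists n, B < t ^+ n.
Proof.
move=> t1.
have t10 : 0 < t - 1 by rewrite subr_gt0.
pose c := `|B| / (t - 1); pose n := `|Num.ceil c|%N.
have c0 : 0 <= Num.ceil c.
  by rewrite ceil_ge0 (lt_le_trans (ltrN10 _))// divr_ge0// ltW.
exists n; rewrite -(subrKC 1 t).
apply: lt_le_trans (bernoulli_le _ _); last by rewrite (le_trans _ (ltW t10)) ?oppr_le0.
apply: le_lt_trans (ler_norm B) _.
apply: (@le_lt_trans _ _ (n%:R * (t - 1))); last by rewrite ltrDr.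
by rewrite -ler_pdivrMr// /n natr_absz (ger0_norm c0) ceil_ge.
Qed.

(** The perturbation that makes a constant comparison function strictly superharmonic. The expansion
    is exact, so the cubic term is 0. *)
Lemma sqnorm_superharmonic (e : R) (p : R * R) : 0 < e ->
  strictly_superharmonic (fun q => - (e * (q.1 ^+ 2 + q.2 ^+ 2))) p.
Proof.
move=> e0; exists (Complex (- (2 * e * p.1)) (2 * e * p.2)), (Complex 0 0).
exists e, 0, 1; split => // h _.
rewrite Re_quadratic.
case: h => s t; rewrite normc_sqr/=.
by rewrite le_eqVlt; apply/orP; left; apply/eqP; ring.
Qed.

(* Compare [G ^ n / z] with its boundary values on the annulus
   [delta <= |z| <= rho]: dividing by [z] makes the outer circle negligible as
   [rho] grows, and [n] tends to infinity. *)
Lemma bounded_outside_disc G (B delta omega : R) : 0 < delta -> 0 < omega ->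
  (forall z, taylor2 G z) -> (forall z, normc (G z) <= B) ->
  (forall z, normc z = delta -> normc (G z) <= omega) ->
  forall z, delta <= normc z -> normc (G z) <= omega.
Proof.
move=> d0 o0 TG GB Gd [x y] dz; set z := Complex x y in dz *.
have z0 : 0 < normc z by exact: lt_le_trans dz.
(* If |G z| > omega, the powers of |G z| / omega are unbounded and eventually exceed |z| / delta. *)
suff H n : normc (G z) ^+ n / normc z <= omega ^+ n / delta.
  rewrite leNgt; apply/negP => oG.
  have oG1 : 1 < normc (G z) / omega by rewrite ltr_pdivlMr// mul1r.
  have [n] := expr_unbounded (normc z / delta) oG1.
  apply/negP; rewrite -leNgt expr_div_n ler_pdivrMr ?exprn_gt0//.
  have := H n; rewrite ler_pdivrMr// => /le_trans; apply.
  by rewrite le_eqVlt; apply/orP; left; apply/eqP; ring.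
have B0 : 0 <= B by exact: le_trans (normc_ge0 _) (GB 0).
(* Large enough to contain z and to make B^n / rho <= omega^n / delta on the outer circle. *)
pose rho := normc z + B ^+ n * delta / omega ^+ n.
have rho0 : 0 < rho.
  by rewrite ltr_wpDr// divr_ge0 ?mulr_ge0 ?exprn_ge0// ltW.
suff He e : 0 < e -> normc (G z) ^+ n / normc z <=
    omega ^+ n / delta * expR (e * rho ^+ 2).
  apply: ler_expR_at_right0; near=> e; apply: He.
  by near: e; exact: nbhs_right_gt.
move=> e0.
pose D : set (R * R) := [set p | 0 <= p.1 ^+ 2 + p.2 ^+ 2 - delta ^+ 2] `&`
  [set p | 0 <= rho ^+ 2 - (p.1 ^+ 2 + p.2 ^+ 2)].
have c1 : continuous (fun p : R * R => p.1 ^+ 2 + p.2 ^+ 2 - delta ^+ 2).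
  by move=> p; apply: cvgB; [exact: continuous_sqnormR|exact: cvg_cst].
have c2 : continuous (fun p : R * R => rho ^+ 2 - (p.1 ^+ 2 + p.2 ^+ 2)).
  by move=> p; apply: cvgB; [exact: cvg_cst|exact: continuous_sqnormR].
have cD : compact D.
  apply: (@compact_in_disc _ _ (rho ^+ 2)); last by move=> p [_ /=]; rewrite subr_ge0.
  by apply: closedI; exact: closed_nonneg.
pose F w := G w ^+ n * w^-1.
have nF w : normc (F w) = normc (G w) ^+ n / normc w.
  by rewrite normcM normcX normcV.
pose phi (q : R * R) := - (e * (q.1 ^+ 2 + q.2 ^+ 2)).
have sqE (u : C) t : 0 <= t -> normc u ^+ 2 = t ^+ 2 -> normc u = t.
  by move=> t0 /eqP; rewrite eqrXn2 ?normc_ge0// => /eqP.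
(* The exponential compensates for exp(phi), which is at least exp(- e rho^2) on [D]. *)
pose K := omega ^+ n / delta * expR (e * rho ^+ 2).
have K0 : 0 <= K by rewrite mulr_ge0 ?expR_ge0// divr_ge0 ?exprn_ge0// ltW.
have Kphi (p : R * R) : p.1 ^+ 2 + p.2 ^+ 2 <= rho ^+ 2 ->
    omega ^+ n / delta <= K * expR (phi p).
  move=> pr; rewrite /K -mulrA -expRD ler_peMr//.
    by rewrite divr_ge0 ?exprn_ge0// ltW.
  rewrite -expR0 ler_expR /phi -mulrBr mulr_ge0 ?(ltW e0)//.
  by rewrite subr_ge0.
have zr : normc z ^+ 2 <= rho ^+ 2.
  rewrite lerXn2r ?nnegrE ?normc_ge0 ?(ltW rho0)// lerDl.
  by rewrite divr_ge0 ?mulr_ge0 ?exprn_ge0// ltW.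
have : normc (F z) <= K * expR (phi (x, y)).
  apply: (@maximum_principle R F phi D K K0 cD) (x, y) _; last first.
    split; rewrite /= subr_ge0 -normc_sqr -/z//.
    by rewrite lerXn2r ?nnegrE ?normc_ge0// ltW.
  - move=> p [/=]; rewrite !subr_ge0 -normc_sqr => p1 p2.
    have := p1; rewrite le_eqVlt => /orP[/eqP p1E|p1p].
      left; rewrite nF; apply: le_trans (Kphi p _); last by rewrite -normc_sqr.
      have pd := sqE _ _ (ltW d0) (esym p1E).
      rewrite pd ler_wpM2r ?invr_ge0 ?(ltW d0)// lerXn2r ?nnegrE ?normc_ge0 ?(ltW o0)//.
      exact: Gd.
    have := p2; rewrite le_eqVlt => /orP[/eqP p2E|p2p].
      left; rewrite nF; apply: le_trans (Kphi p _); last by rewrite -normc_sqr.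
      rewrite (sqE _ _ (ltW rho0) p2E).
      apply: (@le_trans _ _ (B ^+ n / rho)).
        by rewrite ler_wpM2r ?invr_ge0 ?(ltW rho0)// lerXn2r ?nnegrE ?normc_ge0.
      rewrite ler_pdivrMr// mulrDr ler_wpDl//.
        by rewrite mulr_ge0 ?normc_ge0// divr_ge0 ?exprn_ge0// ltW.
      rewrite le_eqVlt; apply/orP; left; apply/eqP.
      by field; rewrite !gt_eqF ?exprn_gt0.
    right; split; last exact: sqnorm_superharmonic.
    have n1 : \forall q \near p, 0 < q.1 ^+ 2 + q.2 ^+ 2 - delta ^+ 2.
      by apply: cvgr_gt (c1 p) _ _; rewrite subr_gt0 -normc_sqr.
    have n2 : \forall q \near p, 0 < rho ^+ 2 - (q.1 ^+ 2 + q.2 ^+ 2).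
      by apply: cvgr_gt (c2 p) _ _; rewrite subr_gt0 -normc_sqr.
    by move: n1 n2; apply: filterS2 => q q1 q2; split; exact: ltW.
  - move=> p [/=]; rewrite !subr_ge0 -normc_sqr => p1 p2; split.
      apply: taylor2M; first exact: taylor2X.
      apply: taylor2_inv; apply/eqP => p0; move: p1; rewrite p0 normc0 expr0n.
      by rewrite leNgt exprn_gt0.
    by apply: cvgN; apply: cvgMr; exact: continuous_sqnormR.
rewrite nF => /le_trans; apply; rewrite ler_piMr//.
by rewrite -expR0 ler_expR oppr_le0 mulr_ge0 ?addr_ge0 ?sqr_ge0// ltW.
Unshelve. all: by end_near. Qed.

(** On the circle |w| = d the difference F - F 0 is O(d). [bounded_outside_disc] carries this bound
    to every point outside, and d tends to 0. *)
Lemma liouville F (B : R) : (forall z, taylor2 F z) ->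
  (forall z, normc (F z) <= B) -> forall z, F z = F 0.
Proof.
move=> TF FB z.
pose G w := F w + - F 0.
have TG w : taylor2 G w by apply: taylor2D => //; exact: taylor2_cst.
have GB w : normc (G w) <= B + B.
  by apply: le_trans (normcD_le _ _) _; rewrite normc_opp lerD.
have [r [K [r0 rK]]] := taylor2_vanishes1 (TF 0).
suff : normc (G z) <= 0.
  move=> G0; have : normc (G z) = 0 by apply/eqP; rewrite eq_le G0 normc_ge0.
  by move/eq0_normc/eqP; rewrite subr_eq0 => /eqP.
have [->|z0] := eqVneq z 0; first by rewrite /G subrr normc0.
have nz : 0 < normc z.
  by rewrite lt_def normc_ge0 andbT; apply: contra z0 => /eqP/eq0_normc ->.
have cd : d @[d --> (0 : R)^'+] --> (0 : R).
  by apply: cvg_at_right_filter; exact: cvg_id.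
have cK : (`|K| + 1) * d @[d --> (0 : R)^'+] --> (`|K| + 1) * 0 by exact: cvgMr.
rewrite mulr0 in cK.
apply: (cvgr_to_ge cK); near=> d.
have d0 : 0 < d by near: d; exact: nbhs_right_gt.
apply: (bounded_outside_disc d0 _ TG GB).
- by rewrite mulr_gt0// ltr_wpDl.
- move=> w wd; have dr : d <= r by near: d; exact: nbhs_right_le.
  have := rK w; rewrite wd add0r expr1 => /(_ dr) /le_trans; apply.
  by rewrite ler_wpM2r ?(ltW d0)// (le_trans (ler_norm K))// lerDl.
- by near: d; exact: nbhs_right_le.
Unshelve. all: by end_near. Qed.

End PhragmenLindelofLiouville.

(** * Functions with Gaussian decay *)

Section GaussianDomination.
Context {R : realType}.
Local Notation C := R[i].
Local Notation mu := (@lebesgue_measure R).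
Implicit Types (alpha t x y k : R) (g e : R -> R) (f : R -> C).

(** The linear term in the exponent makes the class stable under multiplication by exponentials and
    powers of x. For alpha = 0 it consists of the multipliers of at most exponential growth. *)
Definition gdom alpha g := measurable_fun setT g /\
  exists B k : R, forall x, `|g x| <= B * expR (k * `|x| - alpha * x ^+ 2).

(** Completing the square yields a normal density of mean t / (2 alpha) and variance 1 / (2 alpha),
    whose total mass is 1. *)
Lemma gaussian_eq alpha t x : 0 < alpha ->
  expR (x * t - alpha * x ^+ 2) =
  expR (t ^+ 2 / (4 * alpha)) *
    (normal_peak (Num.sqrt (2 * alpha)^-1))^-1 *
    normal_pdf (t / (2 * alpha)) (Num.sqrt (2 * alpha)^-1) x.
Proof.
move=> a0; set s := Num.sqrt _.
have s0 : 0 < s by rewrite sqrtr_gt0 invr_gt0 mulr_gt0.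
have s2 : s ^+ 2 = (2 * alpha)^-1.
  by rewrite sqr_sqrtr// invr_ge0 mulr_ge0// ltW.
rewrite normal_pdfE ?gt_eqF// -mulrA mulKf; last first.
  by rewrite gt_eqF// normal_peak_gt0// gt_eqF.
rewrite /normal_fun s2 -expRD; congr expR.
by rewrite -mulr_natr; field; rewrite gt_eqF.
Qed.

Lemma integrable_gaussian alpha t : 0 < alpha ->
  mu.-integrable setT (EFin \o (fun x => expR (x * t - alpha * x ^+ 2))).
Proof.
move=> a0; rewrite (_ : _ \o _ = fun x =>
  ((expR (t ^+ 2 / (4 * alpha)) * (normal_peak (Num.sqrt (2 * alpha)^-1))^-1)%:E *
   (normal_pdf (t / (2 * alpha)) (Num.sqrt (2 * alpha)^-1) x)%:E)%E).
  by apply: integrableZl => //; exact: integrable_normal_pdf.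
by apply/funext => x /=; rewrite gaussian_eq// EFinM.
Qed.

Lemma Rintegral_gaussian alpha : 0 < alpha -> exists2 c : R, 0 < c & forall t,
  \int[mu]_x expR (x * t - alpha * x ^+ 2) = c * expR (t ^+ 2 / (4 * alpha)).
Proof.
move=> a0; exists (normal_peak (Num.sqrt (2 * alpha)^-1))^-1.
  by rewrite invr_gt0 normal_peak_gt0// gt_eqF// sqrtr_gt0 invr_gt0 mulr_gt0.
move=> t; under eq_Rintegral do rewrite gaussian_eq//.
rewrite RintegralZl//; last exact: integrable_normal_pdf.
by rewrite /Rintegral integral_normal_pdf mulr1 mulrC.
Qed.

Lemma gdom_nonneg alpha g : gdom alpha g -> exists B k : R, [/\ 0 <= B, 0 <= k &
  forall x, `|g x| <= B * expR (k * `|x| - alpha * x ^+ 2)].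
Proof.
move=> [_ [B [k Bk]]]; exists `|B|, `|k|; split => // x.
apply: le_trans (Bk x) _.
apply: le_trans (ler_wpM2r (expR_ge0 _) (ler_norm B)) _.
by rewrite ler_wpM2l// ler_expR lerD2r ler_wpM2r// ler_norm.
Qed.

Lemma gdom_le alpha g e : measurable_fun setT g ->
  (forall x, `|g x| <= `|e x|) -> gdom alpha e -> gdom alpha g.
Proof.
move=> mg ge [_ [B [k Bk]]]; split => //; exists B, k => x.
exact: le_trans (Bk x).
Qed.

Lemma gdom_integrable alpha g : 0 < alpha -> gdom alpha g ->
  mu.-integrable setT (EFin \o g).
Proof.
move=> a0 gg; have [mg _] := gg; have [B [k [B0 k0 Bk]]] := gdom_nonneg gg.
apply: (@le_integrable _ _ _ mu _ measurableT _ (fun x =>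
  ((B * expR (k ^+ 2 / (2 * alpha)))%:E * (expR (x * 0 - alpha / 2 * x ^+ 2))%:E)%E)).
- exact/measurable_EFinP.
- move=> x _ /=; rewrite lee_fin (le_trans (Bk x))//.
  rewrite [leRHS]ger0_norm; last by rewrite !mulr_ge0 ?expR_ge0.
  rewrite -[leRHS]mulrA -expRD ler_wpM2l// ler_expR.
  rewrite -(real_normK (num_real x)).
  (* Half of the Gaussian decay absorbs the linear term: k |x| <= alpha x^2 / 2 + k^2 / (2
     alpha). *)
  have : 0 <= (alpha / 2) * (`|x| - k / alpha) ^+ 2.
    by rewrite mulr_ge0 ?sqr_ge0// divr_ge0// ltW.
  have -> : (alpha / 2) * (`|x| - k / alpha) ^+ 2 =
     alpha / 2 * `|x| ^+ 2 - k * `|x| + k ^+ 2 / (2 * alpha).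
    by field; rewrite gt_eqF.
  clear; lra.
- apply: integrableZl => //; apply: integrable_gaussian.
  by rewrite divr_gt0.
Qed.

Lemma gdomM (a b : R) g e : gdom a g -> gdom b e ->
  gdom (a + b) (fun x => g x * e x).
Proof.
move=> [mg [B [k Bk]]] [me [B' [k' Bk']]]; split; first exact: measurable_funM.
exists (B * B'), (k + k') => x; rewrite normrM.
have -> : (k + k') * `|x| - (a + b) * x ^+ 2 =
  (k * `|x| - a * x ^+ 2) + (k' * `|x| - b * x ^+ 2) by ring.
by rewrite expRD mulrACA ler_pM.
Qed.

Lemma gdomMr alpha g e : gdom alpha g -> gdom 0 e ->
  gdom alpha (fun x => g x * e x).
Proof. by move=> gg ge; rewrite -(addr0 alpha); exact: gdomM. Qed.

Lemma gdomD alpha g e : gdom alpha g -> gdom alpha e ->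
  gdom alpha (fun x => g x + e x).
Proof.
move=> gg ge; split; first by apply: measurable_funD; [case: gg|case: ge].
have [B [k [B0 k0 Bk]]] := gdom_nonneg gg.
have [B' [k' [B'0 k'0 Bk']]] := gdom_nonneg ge.
exists (B + B'), (k + k') => x.
apply: le_trans (ler_normD _ _) _; rewrite mulrDl; apply: lerD.
  apply: le_trans (Bk x) _; rewrite ler_wpM2l// ler_expR lerD2r ler_wpM2r//.
  by rewrite lerDl.
apply: le_trans (Bk' x) _; rewrite ler_wpM2l// ler_expR lerD2r ler_wpM2r//.
by rewrite lerDr.
Qed.

Lemma gdomN alpha g : gdom alpha g -> gdom alpha (fun x => - g x).
Proof.
move=> gg; have [mg _] := gg; apply: gdom_le gg; first exact: measurable_funN.
by move=> x; rewrite normrN.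
Qed.

Lemma gdomB alpha g e : gdom alpha g -> gdom alpha e ->
  gdom alpha (fun x => g x - e x).
Proof. by move=> gg ge; apply: gdomD => //; exact: gdomN. Qed.

Lemma gdom_norm alpha g : gdom alpha g -> gdom alpha (fun x => `|g x|).
Proof.
move=> gg; have [mg _] := gg; apply: gdom_le gg; first exact: measurableT_comp.
by move=> x; rewrite normr_id.
Qed.

Lemma gdom0_bounded e B : measurable_fun setT e -> (forall x, `|e x| <= B) ->
  gdom 0 e.
Proof.
by move=> me eB; split=> //; exists B, 0 => x; rewrite !mul0r subrr expR0 mulr1.
Qed.

Lemma gdom0_cst t : gdom 0 (fun=> t).
Proof. exact: (@gdom0_bounded _ `|t|). Qed.

Lemma gdomZ alpha t g : gdom alpha g -> gdom alpha (fun x => t * g x).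
Proof.
move=> gg; rewrite -(add0r alpha); apply: gdomM => //; exact: gdom0_cst.
Qed.

Lemma gdom0_id : gdom 0 id.
Proof.
split=> //; exists 1, 1 => x; rewrite mul0r subr0 !mul1r.
by apply: le_trans (expR_ge1Dx _); rewrite lerDr.
Qed.

Lemma gdom0_expR t : gdom 0 (fun x => expR (t * x)).
Proof.
split; first by apply: measurableT_comp => //; exact: measurable_funM.
exists 1, `|t| => x; rewrite mul0r subr0 mul1r ger0_norm ?expR_ge0//.
by rewrite ler_expR -normrM ler_norm.
Qed.

Lemma gdom0_expR_norm t : gdom 0 (fun x => expR (t * `|x|)).
Proof.
split; first by apply: measurableT_comp => //; exact: measurable_funM.
exists 1, t => x; rewrite mul0r subr0 mul1r ger0_norm ?expR_ge0//.
Qed.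

Lemma measurable_cosM t : measurable_fun setT (fun x => cos (t * x)).
Proof.
apply: measurableT_comp; last exact: measurable_funM.
by apply: continuous_measurable_fun; exact: continuous_cos.
Qed.

Lemma measurable_sinM t : measurable_fun setT (fun x => sin (t * x)).
Proof.
apply: measurableT_comp; last exact: measurable_funM.
by apply: continuous_measurable_fun; exact: continuous_sin.
Qed.

Lemma gdom0_cos t : gdom 0 (fun x => cos (t * x)).
Proof.
apply: (@gdom0_bounded _ 1); first exact: measurable_cosM.
by move=> x; rewrite ler_norml cos_geN1 cos_le1.
Qed.

Lemma gdom0_sin t : gdom 0 (fun x => sin (t * x)).
Proof.
apply: (@gdom0_bounded _ 1); first exact: measurable_sinM.
by move=> x; rewrite ler_norml sin_geN1 sin_le1.
Qed.

Lemma le_norm_Rintegral_gdom alpha g e : 0 < alpha -> gdom alpha g ->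
  gdom alpha e -> (forall x, `|g x| <= e x) ->
  `|\int[mu]_x g x| <= \int[mu]_x e x.
Proof.
move=> a0 gg ge gle; have ig := gdom_integrable a0 gg.
apply: le_trans (le_normr_Rintegral measurableT ig) _.
apply: le_Rintegral => //; first exact: integrable_norm.
exact: gdom_integrable ge.
Qed.

End GaussianDomination.

(** * Complex integrals and the Laplace transform *)

Section ComplexIntegral.
Context {R : realType}.
Local Notation C := R[i].
Local Notation mu := (@lebesgue_measure R).
Implicit Types (alpha x t : R) (g : R -> R) (f h e : R -> C) (z w : C).

Lemma complex_ReD z w : complex.Re (z + w) = complex.Re z + complex.Re w.
Proof. by case: z w => [a b] [c d]. Qed.

Lemma complex_ImD z w : complex.Im (z + w) = complex.Im z + complex.Im w.
Proof. by case: z w => [a b] [c d]. Qed.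

Lemma complex_ReM z w : complex.Re (z * w) =
  complex.Re z * complex.Re w - complex.Im z * complex.Im w.
Proof. by case: z w => [a b] [c d]. Qed.

Lemma complex_ImM z w : complex.Im (z * w) =
  complex.Re z * complex.Im w + complex.Im z * complex.Re w.
Proof. by case: z w => [a b] [c d]. Qed.

Definition cdom alpha f := gdom alpha (fun x => complex.Re (f x)) /\
  gdom alpha (fun x => complex.Im (f x)).

Lemma cdomD alpha f e : cdom alpha f -> cdom alpha e ->
  cdom alpha (fun x => f x + e x).
Proof.
move=> [f1 f2] [e1 e2]; split.
  by under eq_fun do rewrite complex_ReD; exact: gdomD.
by under eq_fun do rewrite complex_ImD; exact: gdomD.
Qed.

Lemma cdomM alpha f e : cdom alpha f -> cdom 0 e ->
  cdom alpha (fun x => f x * e x).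
Proof.
move=> [f1 f2] [e1 e2]; split.
  by under eq_fun do rewrite complex_ReM; apply: gdomB; exact: gdomMr.
by under eq_fun do rewrite complex_ImM; apply: gdomD; exact: gdomMr.
Qed.

Lemma cdom0_cst z : cdom 0 (fun=> z).
Proof. by split; exact: gdom0_cst. Qed.

Lemma cdom0_real : cdom 0 (fun x => x%:C%C).
Proof. by split; [exact: gdom0_id|exact: gdom0_cst]. Qed.

Lemma cexp_line x z : cexp (x%:C%C * z) =
  Complex (expR (complex.Re z * x) * cos (complex.Im z * x))
          (expR (complex.Re z * x) * sin (complex.Im z * x)).
Proof.
case: z => a b; rewrite /cexp/= !mul0r subr0 addr0.
by rewrite ![x * _]mulrC.
Qed.

Lemma cdom0_cexp z : cdom 0 (fun x => cexp (x%:C%C * z)).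
Proof.
split; under eq_fun do rewrite cexp_line/=.
  by apply: gdomMr; [exact: gdom0_expR|exact: gdom0_cos].
by apply: gdomMr; [exact: gdom0_expR|exact: gdom0_sin].
Qed.

Lemma cintegralD alpha f e : 0 < alpha -> cdom alpha f -> cdom alpha e ->
  cintegral (fun x => f x + e x) = cintegral f + cintegral e.
Proof.
move=> a0 [f1 f2] [e1 e2].
apply/eqP; rewrite eq_complex/=; apply/andP; split; apply/eqP.
  under eq_Rintegral do rewrite complex_ReD.
  by rewrite RintegralD//; exact: (gdom_integrable a0).
under eq_Rintegral do rewrite complex_ImD.
by rewrite RintegralD//; exact: (gdom_integrable a0).
Qed.

Lemma cintegralZr alpha f z : 0 < alpha -> cdom alpha f ->
  cintegral (fun x => f x * z) = cintegral f * z.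
Proof.
move=> a0 [f1 f2]; case: z => a b.
have i1 := gdom_integrable a0 f1; have i2 := gdom_integrable a0 f2.
have iZ t g : gdom alpha g -> mu.-integrable setT (EFin \o (fun x => g x * t)).
  move=> gg; apply: (gdom_integrable a0).
  by under eq_fun do rewrite mulrC; exact: gdomZ.
apply/eqP; rewrite eq_complex/=; apply/andP; split; apply/eqP.
  under eq_Rintegral do rewrite complex_ReM/=.
  by rewrite RintegralB ?RintegralZr//; exact: iZ.
under eq_Rintegral do rewrite complex_ImM/=.
by rewrite RintegralD ?RintegralZr//; exact: iZ.
Qed.

(** The factor 2 comes from bounding the two parts separately. It only enlarges constants, and
    Hardy's argument is insensitive to them. *)
Lemma normc_cintegral_le alpha f g : 0 < alpha -> cdom alpha f ->
  gdom alpha g -> (forall x, normc (f x) <= g x) ->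
  normc (cintegral f) <= 2 * \int[mu]_x g x.
Proof.
move=> a0 [f1 f2] gg fg; apply: le_trans (normc_le_ReIm _) _ => /=.
rewrite mulr_natl mulr2n; apply: lerD.
  apply: (le_norm_Rintegral_gdom a0) => // x.
  exact: le_trans (Re_le_normc _) _.
apply: (le_norm_Rintegral_gdom a0) => // x.
exact: le_trans (Im_le_normc _) _.
Qed.

(** Two-sided, so that its restriction to the imaginary axis is a Fourier transform. *)
Definition laplace h z := cintegral (fun x => h x * cexp (x%:C%C * z)).

Lemma gdom0_expr_norm n : gdom (0 : R) (fun x => `|x| ^+ n).
Proof.
elim: n => [|n ih].
  by under eq_fun do rewrite expr0; exact: gdom0_cst.
by under eq_fun do rewrite exprS; apply: gdomMr => //; apply/gdom_norm/gdom0_id.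
Qed.

(** The expansion of exp(x w) in w is integrated term by term; Gaussian decay makes the remainder,
    of size |x w|^3 exp(2 |x w|), integrable. *)
Lemma laplace_taylor2 alpha h z : 0 < alpha -> cdom alpha h ->
  taylor2 (laplace h) z.
Proof.
move=> a0 hh.
pose f x := h x * cexp (x%:C%C * z).
have df : cdom alpha f by apply: cdomM => //; exact: cdom0_cexp.
have dfx : cdom alpha (fun x => f x * x%:C%C) by apply: cdomM => //; exact: cdom0_real.
pose p2 x := x%:C%C * x%:C%C * 2^-1 : C.
have dp2 : cdom 0 p2.
  by apply: cdomM; [apply: cdomM; exact: cdom0_real|exact: cdom0_cst].
have dfp : cdom alpha (fun x => f x * p2 x) by exact: cdomM.
pose G x := (`|complex.Re (h x)| + `|complex.Im (h x)|) *
  expR (complex.Re z * x) * (6 * `|x| ^+ 3 * expR (2 * `|x|)).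
have gG : gdom alpha G.
  apply: gdomMr.
    apply: gdomMr; last exact: gdom0_expR.
    by apply: gdomD; apply: gdom_norm; case: hh.
  apply: gdomMr; last exact: gdom0_expR_norm.
  exact/gdomZ/gdom0_expr_norm.
exists (cintegral (fun x => f x * x%:C%C)), (cintegral (fun x => f x * p2 x)).
(* For |w| <= 1 the factor exp(2 |x w|) is at most exp(2 |x|), so the majorant [G] does not depend
   on w. *)
exists 1, (2 * \int[mu]_x G x); split => // w w1.
pose rho x := cexp (x%:C%C * w) + - 1 + x%:C%C * (- w) + p2 x * (- w ^+ 2).
have drho : cdom 0 rho.
  apply: cdomD; first apply: cdomD; first apply: cdomD.
  - exact: cdom0_cexp.
  - exact: cdom0_cst.
  - by apply: cdomM; [exact: cdom0_real|exact: cdom0_cst].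
  - by apply: cdomM => //; exact: cdom0_cst.
have -> : laplace h (z + w) - (laplace h z +
    cintegral (fun x => f x * x%:C%C) * w + cintegral (fun x => f x * p2 x) * w ^+ 2) =
    cintegral (fun x => f x * rho x).
  have dfxw : cdom alpha (fun x => f x * x%:C%C * w).
    by apply: cdomM => //; exact: cdom0_cst.
  have dfpw : cdom alpha (fun x => f x * p2 x * w ^+ 2).
    by apply: cdomM => //; exact: cdom0_cst.
  have dfr : cdom alpha (fun x => f x * rho x) by exact: cdomM.
  rewrite -!(cintegralZr _ a0)// -(cintegralD a0)// -(cintegralD a0)//; last exact: cdomD.
  apply/eqP; rewrite subr_eq -(cintegralD a0)//; last by do 2 apply: cdomD => //.
  apply/eqP; congr cintegral; apply/funext => x.
  rewrite /f /rho /p2 mulrDr cexpD; by field.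
have gG3 : gdom alpha (fun x => normc w ^+ 3 * G x) by exact: gdomZ.
have : normc (cintegral (fun x => f x * rho x)) <=
    2 * \int[mu]_x (normc w ^+ 3 * G x).
  apply: (normc_cintegral_le a0) => // [|x]; first exact: cdomM.
  rewrite normcM.
  have -> : rho x = cexp (x%:C%C * w) -
     (1 + x%:C%C * w + (x%:C%C * w) ^+ 2 / 2).
    by rewrite /rho /p2; field.
  have fx : normc (f x) <= (`|complex.Re (h x)| + `|complex.Im (h x)|) *
      expR (complex.Re z * x).
    rewrite normcM normc_cexp complex_ReM/= mul0r subr0 [x * _]mulrC.
    by rewrite ler_wpM2r ?expR_ge0// normc_le_ReIm.
  have rx : normc (cexp (x%:C%C * w) - (1 + x%:C%C * w + (x%:C%C * w) ^+ 2 / 2)) <=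
      normc w ^+ 3 * (6 * `|x| ^+ 3 * expR (2 * `|x|)).
    apply: le_trans (cexp_taylor2 _) _; rewrite normcM normcR exprMn.
    have -> : 6 * (`|x| ^+ 3 * normc w ^+ 3) * expR (2 * (`|x| * normc w)) =
      (normc w ^+ 3 * (6 * `|x| ^+ 3)) * expR (2 * (`|x| * normc w)) by ring.
    rewrite [leRHS]mulrA ler_wpM2l//.
      by rewrite !mulr_ge0 ?exprn_ge0 ?normc_ge0.
    by rewrite ler_expR ler_wpM2l// ler_piMr.
  apply: le_trans (ler_pM (normc_ge0 _) (normc_ge0 _) fx rx) _.
  by rewrite /G mulrCA.
rewrite RintegralZl//; last exact: (gdom_integrable a0).
by rewrite mulrCA mulrC.
Qed.

End ComplexIntegral.

(** * Vanishing Laplace transforms *)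

Section LaplaceUniqueness.
Context {R : realType}.
Local Notation mu := (@lebesgue_measure R).
Implicit Types (alpha x t u c s : R) (d f g e : R -> R).

Lemma expR_taylor1 x : `|expR x - (1 + x)| <= `|x| ^+ 2 * expR `|x|.
Proof.
have := @series_dominated_tail R x (exp_coeff x) (expR x) 2.
rewrite /series/= !big_nat_recr//= big_geq// /exp_coeff/=.
rewrite add0r expr0 expr1 !divr1; apply; last exact: is_cvg_series_exp_coeff.
by move=> k; rewrite normrM normfV normrX [`|k`!%:R|]ger0_norm.
Qed.

(** Differentiation in u under the integral: the increment from u to u + t is 0 and differs from t I
    by O(t^2), so |I| <= t K for all small t. *)
Lemma laplace_eq0_mulx alpha d : 0 < alpha -> gdom alpha d ->
  (forall u, \int[mu]_x (d x * expR (u * x)) = 0) ->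
  forall u, \int[mu]_x (d x * x * expR (u * x)) = 0.
Proof.
move=> a0 dd d0 u; set I := \int[mu]_x _.
pose G x := `|d x| * expR (u * x) * (`|x| ^+ 2 * expR (1 * `|x|)).
have gG : gdom alpha G.
  apply: gdomMr; first by apply: gdomMr; [exact: gdom_norm|exact: gdom0_expR].
  by apply: gdomMr; [exact: gdom0_expr_norm|exact: gdom0_expR_norm].
pose K := \int[mu]_x G x.
have bnd t : 0 < t -> t <= 1 -> `|I| <= t * K.
  move=> t0 t1.
  pose f1 x := d x * expR ((u + t) * x).
  pose f2 x := d x * expR (u * x).
  pose f3 x := d x * x * expR (u * x).
  have g1 : gdom alpha f1 by apply: gdomMr => //; exact: gdom0_expR.
  have g2 : gdom alpha f2 by apply: gdomMr => //; exact: gdom0_expR.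
  have g3 : gdom alpha f3.
    apply: gdomMr; last exact: gdom0_expR.
    by apply: gdomMr => //; exact: gdom0_id.
  have g12 : gdom alpha (fun x => f1 x - f2 x) by exact: gdomB.
  have i3 : \int[mu]_x (f1 x - f2 x - t * f3 x) = - (t * I).
    have gi g : gdom alpha g -> mu.-integrable setT (EFin \o g).
      exact: gdom_integrable.
    rewrite RintegralB//; [|exact: gi|apply: gi; exact: gdomZ].
    rewrite RintegralB//; [|exact: gi|exact: gi].
    rewrite RintegralZl//; last exact: gi.
    by rewrite /f1 /f2 !d0 subrr sub0r.
  have : `|- (t * I)| <= \int[mu]_x (t ^+ 2 * G x).
    rewrite -i3; apply: (le_norm_Rintegral_gdom a0).
    - by apply: gdomB => //; exact: gdomZ.
    - exact: gdomZ.
    - move=> x.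
      have -> : f1 x - f2 x - t * f3 x =
          d x * expR (u * x) * (expR (t * x) - (1 + t * x)).
        by rewrite /f1 /f2 /f3 mulrDl expRD; ring.
      rewrite /G mul1r !normrM [`|expR _|]ger0_norm ?expR_ge0// mulrCA.
      rewrite ler_wpM2l ?mulr_ge0 ?expR_ge0//.
      apply: le_trans (expR_taylor1 _) _.
      rewrite normrM exprMn (ger0_norm (ltW t0)) -mulrA.
      by rewrite !ler_wpM2l ?exprn_ge0 ?(ltW t0)// ler_expR ler_piMl.
  rewrite RintegralZl//; last exact: (gdom_integrable a0).
  by rewrite normrN normrM (gtr0_norm t0) expr2 -mulrA ler_pM2l.
have ct : t * K @[t --> (0 : R)^'+] --> 0 * K.
  by apply: cvgMl; apply: cvg_at_right_filter; exact: cvg_id.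
apply/eqP; rewrite -normr_le0 -(mul0r K); apply: (cvgr_to_ge ct).
near=> t; apply: bnd.
  by near: t; exact: nbhs_right_gt.
by near: t; exact: nbhs_right_le.
Unshelve. all: by end_near. Qed.

Lemma laplace_eq0_moments alpha d : 0 < alpha -> gdom alpha d ->
  (forall u, \int[mu]_x (d x * expR (u * x)) = 0) ->
  forall n, \int[mu]_x (d x * x ^+ n) = 0.
Proof.
move=> a0 dd d0 n.
(* The induction needs the vanishing at all u; the moments are its values at u = 0. *)
suff : gdom alpha (fun x => d x * x ^+ n) /\
    forall u, \int[mu]_x (d x * x ^+ n * expR (u * x)) = 0.
  move=> [_ /(_ 0)]; under eq_Rintegral do rewrite mul0r expR0 mulr1.
  by [].
elim: n => [|n [ih1 ih2]].
  split=> [|u]; first by under eq_fun do rewrite expr0 mulr1.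
  by under eq_Rintegral do rewrite expr0 mulr1.
split.
  under eq_fun do rewrite exprSr mulrA.
  by apply: gdomMr => //; exact: gdom0_id.
move=> u; under eq_Rintegral do rewrite exprSr mulrA.
exact: (laplace_eq0_mulx a0).
Qed.

(** Dominated convergence. Almost everywhere convergence is allowed because the approximations of a
    half-line fail at its endpoint. *)
Lemma Rintegral_limit_eq0 alpha (f_ : nat -> R -> R) f g : 0 < alpha ->
  (forall n, measurable_fun setT (f_ n)) -> measurable_fun setT f ->
  gdom alpha g -> (forall n x, `|f_ n x| <= g x) ->
  {ae mu, forall x, f_ ^~ x @ \oo --> f x} ->
  (forall n, \int[mu]_x f_ n x = 0) -> \int[mu]_x f x = 0.
Proof.
move=> a0 mf_ mf gg fg cf f0.
have ig := gdom_integrable a0 gg.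
have if_ n : mu.-integrable setT (EFin \o f_ n).
  apply: gdom_integrable a0 _; apply: gdom_le gg => // x.
  by apply: le_trans (fg n x) _; exact: ler_norm.
have mEf_ n : measurable_fun setT (EFin \o f_ n) by exact/measurable_EFinP.
have mEf : measurable_fun setT (EFin \o f) by exact/measurable_EFinP.
have cEf : {ae mu, forall x, setT x -> (EFin \o f_ n) x @[n --> \oo] --> (EFin \o f) x}.
  move: cf; apply: filterS; first exact: (ae_filter_ringOfSetsType mu).
  move=> x cx _; apply: cvg_EFin => //; exact: nearW.
have fEg : {ae mu, forall x n, setT x -> (`|(EFin \o f_ n) x| <= (EFin \o g) x)%E}.
  by apply: aeW => x n _; rewrite lee_fin.
have [_ _] := @dominated_convergence _ _ R mu setT measurableT
  (fun n => EFin \o f_ n) (EFin \o f) (EFin \o g) mEf_ mEf cEf ig fEg.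
have -> : [sequence (\int[mu]_(x in setT) (EFin \o f_ n) x)%E]_n = cst 0%E.
  apply/funext => n /=; rewrite -[LHS]fineK; last exact: integrable_fin_num (if_ n).
  by congr EFin; exact: f0.
move=> h; rewrite /Rintegral.
by rewrite -(cvg_unique (@ereal_hausdorff R) (cvg_cst 0%E) h).
Qed.

(** The partial sums of F(t x) are polynomials, which integrate to 0 against d, and they are
    dominated by exp(|t| |x|) by [series_dominated_le]. *)
Lemma Rintegral_entire_eq0 alpha d (gam : nat -> R) (F : R -> R) t : 0 < alpha ->
  gdom alpha d -> (forall n, \int[mu]_x (d x * x ^+ n) = 0) ->
  measurable_fun setT F ->
  (forall x k, `|gam k * x ^+ k| <= exp_coeff `|x| k) ->
  (forall x, series (fun k => gam k * x ^+ k) @ \oo --> F x) ->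
  \int[mu]_x (d x * F (t * x)) = 0.
Proof.
move=> a0 dd d0 mF gamle gamF; have [md _] := dd.
pose p n x := series (fun k => gam k * (t * x) ^+ k) n.
have gp n : gdom alpha (fun x => d x * p n x) /\ \int[mu]_x (d x * p n x) = 0.
  elim: n => [|n [ih1 ih2]].
    have p0 x : d x * p 0 x = d x * 0 by rewrite /p /series/= big_geq.
    split; first by under eq_fun do rewrite p0; apply: gdomMr => //; exact: gdom0_cst.
    under eq_Rintegral do rewrite p0 mulr0.
    by rewrite Rintegral_cst// mul0r.
  have pS x : d x * p n.+1 x = d x * p n x + gam n * t ^+ n * (d x * x ^+ n).
    by rewrite /p /series/= big_nat_recr//= exprMn; ring.
  have gx : gdom alpha (fun x => d x * x ^+ n).
    apply: gdom_le (gdomMr dd (gdom0_expr_norm n)).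
      by apply: measurable_funM => //; exact: measurable_funX.
    by move=> x; rewrite !normrM !normrX normr_id.
  split; first by under eq_fun do rewrite pS; apply: gdomD => //; exact: gdomZ.
  under eq_Rintegral do rewrite pS.
  rewrite RintegralD//;
    [|exact: (gdom_integrable a0)|by apply: (gdom_integrable a0); exact: gdomZ].
  by rewrite ih2 RintegralZl ?d0 ?mulr0 ?addr0//; exact: (gdom_integrable a0).
apply: (@Rintegral_limit_eq0 alpha (fun n x => d x * p n x) _
  (fun x => `|d x| * expR (`|t| * `|x|)) a0).
- by move=> n; have [[]] := gp n.
- apply: measurable_funM => //; apply: (measurableT_comp mF).
  exact: measurable_funM.
- by apply: gdomMr; [exact: gdom_norm|exact: gdom0_expR_norm].
- move=> n x; rewrite normrM ler_wpM2l// -normrM.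
  by apply: series_dominated_le => k; exact: gamle.
- by apply: aeW => x; apply: cvgMr; exact: gamF.
- by move=> n; have [] := gp n.
Qed.

Lemma gdom0_cosD t c : gdom 0 (fun x => cos (t * x + c)).
Proof.
apply: (@gdom0_bounded _ _ 1).
  apply: measurableT_comp.
    by apply: continuous_measurable_fun; exact: continuous_cos.
  by apply: measurable_funD => //; exact: measurable_funM.
by move=> x; rewrite ler_norml cos_geN1 cos_le1.
Qed.

(** The phase [c] includes the sines and makes the family of test functions stable under
    product-to-sum formulas. *)
Definition trig_null alpha d := gdom alpha d /\
  forall t c, \int[mu]_x (d x * cos (t * x + c)) = 0.

Lemma moments_eq0_trig_null alpha d : 0 < alpha -> gdom alpha d ->
  (forall n, \int[mu]_x (d x * x ^+ n) = 0) -> trig_null alpha d.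
Proof.
move=> a0 dd d0; split=> // t c.
have dcos : gdom alpha (fun x => d x * cos (t * x)).
  by apply: gdomMr => //; exact: gdom0_cos.
have dsin : gdom alpha (fun x => d x * sin (t * x)).
  by apply: gdomMr => //; exact: gdom0_sin.
under eq_Rintegral do rewrite cosD mulrBr !mulrA ![_ * cos c]mulrC ![_ * sin c]mulrC.
rewrite RintegralB//; try by apply: (gdom_integrable a0); exact: gdomZ.
rewrite !RintegralZl//; try exact: (gdom_integrable a0).
rewrite (@Rintegral_entire_eq0 alpha d
  (fun k => (~~ odd k)%:R * (-1) ^+ k./2 * (k`!%:R)^-1))//; last 3 first.
- by apply: continuous_measurable_fun; exact: continuous_cos.
- by move=> x k; have := norm_cos_coeff_le x k; rewrite cos_coeffE.
- by move=> x; have := @cvg_series_cos_coeff R x; rewrite cos_coeffE.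
rewrite (@Rintegral_entire_eq0 alpha d
  (fun k => (odd k)%:R * (-1) ^+ k.-1./2 * (k`!%:R)^-1))//; last 3 first.
- by apply: continuous_measurable_fun; exact: continuous_sin.
- by move=> x k; have := norm_sin_coeff_le x k; rewrite sin_coeffE.
- by move=> x; have := @cvg_series_sin_coeff R x; rewrite sin_coeffE.
by rewrite !mulr0 subrr.
Qed.

(** Trigonometric polynomials are handled as multipliers: stability under products gives all powers
    at once, with no expansion into frequencies. *)
Definition trig_multiplier alpha e :=
  forall d, trig_null alpha d -> trig_null alpha (fun x => d x * e x).

Lemma trig_multiplier1 alpha : trig_multiplier alpha (fun=> 1).
Proof. by move=> d; under eq_fun do rewrite mulr1. Qed.

Lemma trig_multiplierM alpha e g : trig_multiplier alpha e ->
  trig_multiplier alpha g -> trig_multiplier alpha (fun x => e x * g x).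
Proof. by move=> me mg d /me/mg; under eq_fun do rewrite -mulrA. Qed.

Lemma trig_multiplierX alpha e n : trig_multiplier alpha e ->
  trig_multiplier alpha (fun x => e x ^+ n).
Proof.
move=> me; elim: n => [|n ih]; first exact: trig_multiplier1.
by under eq_fun do rewrite exprS; exact: trig_multiplierM.
Qed.

Lemma trig_nullD alpha d g p q : 0 < alpha -> trig_null alpha d ->
  trig_null alpha g -> trig_null alpha (fun x => p * d x + q * g x).
Proof.
move=> a0 [dd d0] [gg g0]; split; first by apply: gdomD; exact: gdomZ.
move=> t c.
have gc := gdom0_cosD t c.
under eq_Rintegral do rewrite mulrDl -!mulrA.
have dc := gdomMr dd gc; have gcc := gdomMr gg gc.
rewrite RintegralD//; try by apply: (gdom_integrable a0); exact: gdomZ.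
rewrite !RintegralZl//; try exact: (gdom_integrable a0).
by rewrite d0 g0 !mulr0 addr0.
Qed.

Lemma trig_multiplierB1 alpha e : 0 < alpha -> trig_multiplier alpha e ->
  trig_multiplier alpha (fun x => 1 - e x).
Proof.
move=> a0 me d zd; have := trig_nullD 1 (-1) a0 zd (me _ zd).
by under eq_fun do rewrite mul1r mulN1r -{1}(mulr1 (d _)) -mulrBr.
Qed.

Lemma trig_multiplier_cos alpha p q s c : 0 < alpha ->
  trig_multiplier alpha (fun x => p + q * cos (s * x + c)).
Proof.
move=> a0 d zd; have [dd d0] := zd.
have gc := @gdom0_cosD.
have zc : trig_null alpha (fun x => d x * cos (s * x + c)).
  split; first exact: gdomMr.
  move=> t b.
  have E x : d x * cos (s * x + c) * cos (t * x + b) =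
      2^-1 * (d x * cos ((s + t) * x + (c + b))) +
      2^-1 * (d x * cos ((s - t) * x + (c - b))).
    have -> : (s + t) * x + (c + b) = (s * x + c) + (t * x + b) by ring.
    have -> : (s - t) * x + (c - b) = (s * x + c) - (t * x + b) by ring.
    by rewrite (cosD (s * x + c)) (cosB (s * x + c)); field.
  under eq_Rintegral do rewrite E.
  rewrite RintegralD//; try by apply: (gdom_integrable a0); apply: gdomZ; exact: gdomMr.
  rewrite !RintegralZl//; try by apply: (gdom_integrable a0); exact: gdomMr.
  by rewrite !d0 !mulr0 addr0.
have := trig_nullD p q a0 zd zc.
by under eq_fun do rewrite [p * _]mulrC mulrCA -mulrDr.
Qed.

End LaplaceUniqueness.

(** * Approximation of half-lines by trigonometric polynomials *)

Section StepApproximation.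
Context {R : realType}.
Local Notation mu := (@lebesgue_measure R).
Implicit Types (alpha x a s : R) (d : R -> R).

Lemma sin_ge_half x : 0 <= x <= 1 / 4 -> x / 2 <= sin x.
Proof.
move=> /andP[x0 x4].
(* From (1 - x) exp x <= 1 with x <= 1/4. The cubic remainder of the sine is then at most x / 12. *)
have ex : expR x <= 4 / 3.
  have e0 := expR_gt0 x.
  have := ler_wpM2r (ltW e0) (expR_ge1Dx (- x)).
  rewrite -expRD addNr expR0.
  have : x * expR x <= 1 / 4 * expR x by rewrite ler_wpM2r// ltW.
  clear -x4; lra.
have := sin_taylor2 x; rewrite (ger0_norm x0) ler_norml => /andP[h _].
have x3 : x ^+ 3 * expR x <= x ^+ 3 * (4 / 3) by rewrite ler_wpM2l ?exprn_ge0.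
have x2 : x ^+ 2 <= (1 / 4) ^+ 2 by rewrite lerXn2r ?nnegrE.
have := ler_wpM2l x0 x2; clear -x0 h x3; lra.
Qed.

(* As [N] grows, [step N s] tends to [1] for [- 1 <= s < 0] and to [0] for
   [0 < s <= 1]. *)
Definition step N s : R := (1 - ((1 + s) / 2) ^+ N) ^+ (2 ^ N).

Lemma step_bounded N s : -1 <= s <= 1 -> 0 <= step N s <= 1.
Proof.
move=> /andP[s0 s1].
have u0 : 0 <= (1 + s) / 2 by rewrite divr_ge0// -lerBlDl sub0r.
have u1 : (1 + s) / 2 <= 1 by clear -s1; lra.
have uN0 := exprn_ge0 N u0; have uN1 := exprn_ile1 N u0 u1.
by rewrite /step exprn_ge0 ?subr_ge0//= exprn_ile1 ?subr_ge0// lerBlDr lerDl.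
Qed.

(** The reason for the exponent 2^N: the size of [step N s] is governed by exp(- (1 + s)^N), whose
    exponent tends to minus infinity or to 0 according to the sign of s. *)
Lemma step_half N s : 2 ^+ N * ((1 + s) / 2) ^+ N = (1 + s) ^+ N.
Proof. by rewrite -exprMn mulrC divfK// pnatr_eq0. Qed.

Lemma step_right N s : 0 < s <= 1 -> step N s <= (1 + N%:R * s)^-1.
Proof.
move=> /andP[s0 s1].
have u0 : 0 <= (1 + s) / 2 by rewrite divr_ge0// addr_ge0// ltW.
have u1 : (1 + s) / 2 <= 1 by clear -s1; lra.
have uN1 := exprn_ile1 N u0 u1.
have Ns : 0 <= N%:R * s by rewrite mulr_ge0// ltW.
apply: (@le_trans _ _ (expR (- (1 + s) ^+ N))).
  rewrite -step_half -natrX -mulrN expRM_natl /step lerXn2r ?nnegrE ?expR_ge0//.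
    by rewrite subr_ge0.
  exact: expR_ge1Dx.
rewrite expRN lef_pV2 ?posrE ?expR_gt0//; last by rewrite ltr_wpDr.
apply: le_trans (bernoulli_le _ _) _; first by apply: le_trans (ltW s0); rewrite lerN10.
apply: le_trans (expR_ge1Dx _); by rewrite lerDr.
Qed.

Lemma step_left N s : 0 < s <= 1 -> 1 - (1 + N%:R * s)^-1 <= step N (- s).
Proof.
move=> /andP[s0 s1].
have u0 : 0 <= (1 - s) / 2 by rewrite divr_ge0// subr_ge0.
have u1 : (1 - s) / 2 <= 1 by clear -s0; lra.
have uN0 := exprn_ge0 N u0; have uN1 := exprn_ile1 N u0 u1.
have Ns : 0 <= N%:R * s by rewrite mulr_ge0// ltW.
apply: le_trans (bernoulli_le _ _); last by rewrite lerN2.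
rewrite mulrN lerB// natrX step_half.
apply: (@le_trans _ _ (expR (- (N%:R * s)))).
  rewrite -mulrN expRM_natl lerXn2r ?nnegrE ?expR_ge0 ?subr_ge0//.
  exact: expR_ge1Dx.
rewrite expRN lef_pV2 ?posrE ?expR_gt0//; last by rewrite ltr_wpDr.
exact: expR_ge1Dx.
Qed.

(** Dividing by n + 1 stretches the period of the sine until y lies on its first monotone arc. The
    square in N = (n + 1)^2 makes N sin(|y| / (n + 1)) >= (n + 1) |y| / 2 tend to infinity
    nevertheless. *)
Lemma step_sin_cvg (y : R) : y != 0 ->
  step (n.+1 ^ 2) (sin (y / n.+1%:R)) @[n --> \oo] --> ((y < 0)%R%:R : R).
Proof.
move=> y0; have ny0 : 0 < `|y| by rewrite normr_gt0.
have ch (c : R) : ((y < 0)%R%:R : R) + c * n.+1%:R^-1 @[n --> \oo] --> ((y < 0)%R%:R : R).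
  rewrite -[X in _ --> X]addr0; apply: cvgD; first exact: cvg_cst.
  rewrite -[X in _ --> X](mulr0 c); apply: cvgMr; exact: cvg_harmonic.
apply: (squeeze_cvgr _ (ch (- (2 / `|y|))) (ch (2 / `|y|))).
have : \forall n \near \oo, 4 * `|y| <= n%:R.
  exact: nbhs_infty_ger.
apply: filterS => n yn.
have n0 : 0 < n.+1%:R :> R by rewrite ltr0n.
pose th := `|y| / n.+1%:R.
have th0 : 0 < th by rewrite divr_gt0.
have th4 : th <= 1 / 4.
  rewrite ler_pdivrMr// -[n.+1%:R]natr1; move: yn; clear; lra.
pose s := sin th.
have s2 : th / 2 <= s by apply: sin_ge_half; rewrite ltW.
have s01 : 0 < s <= 1 by rewrite sin_le1 andbT (lt_le_trans _ s2)// divr_gt0.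
have inv : (1 + (n.+1 ^ 2)%:R * s)^-1 <= 2 / `|y| * n.+1%:R^-1.
  rewrite -invf_div lef_pV2 ?posrE.
  - apply: (@le_trans _ _ ((n.+1 ^ 2)%:R * (th / 2))).
      rewrite le_eqVlt; apply/orP; left; apply/eqP.
      by rewrite natrX /th; field; rewrite !gt_eqF.
    by rewrite ler_wpDl// ler_wpM2l.
  - by rewrite ltr_wpDr// mulr_ge0// ltW//; case/andP: s01.
  - by rewrite !divr_gt0.
rewrite mulNr -ler_distl.
apply: le_trans inv.
have /andP[st0 st1] : 0 <= step (n.+1 ^ 2) (sin (y / n.+1%:R)) <= 1.
  by apply: step_bounded; rewrite sin_geN1 sin_le1.
move: y0; rewrite neq_lt => /orP[yn0|yp0].
  rewrite yn0 [true%:R]/(1 : R) ler0_norm ?subr_le0// opprB.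
  have -> : sin (y / n.+1%:R) = - s.
    by rewrite /s /th ltr0_norm// mulNr sinN opprK.
  by rewrite lerBlDl -lerBlDr step_left.
rewrite ltNge (ltW yp0) subr0 ger0_norm//.
have -> : sin (y / n.+1%:R) = s by rewrite /s /th gtr0_norm.
exact: step_right.
Qed.

Lemma trig_null_ray alpha d a : 0 < alpha -> trig_null alpha d ->
  \int[mu]_(x in `]-oo, a]) d x = 0.
Proof.
move=> a0 zd; have [dd _] := zd; have [md _] := dd.
pose e n x := step (n.+1 ^ 2) (sin ((x - a) / n.+1%:R)).
have ze n : trig_null alpha (fun x => d x * e n x).
  (* The phase - pi / 2 turns the cosine into the sine, so that the innermost multiplier is (1 +
     sin) / 2. *)
  have := trig_multiplierX (2 ^ (n.+1 ^ 2)) (trig_multiplierB1 a0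
    (trig_multiplierX (n.+1 ^ 2) (@trig_multiplier_cos R alpha (1 / 2) (1 / 2)
      n.+1%:R^-1 (- (a / n.+1%:R) - pi / 2) a0))) zd.
  congr (trig_null _ _); apply/funext => x; congr (_ * _).
  rewrite /e /step; congr (_ ^+ _); congr (1 - _ ^+ _).
  have -> : n.+1%:R^-1 * x + (- (a / n.+1%:R) - pi / 2) =
      (x - a) / n.+1%:R - pi / 2 by ring.
  by rewrite cosBpihalf; field.
rewrite Rintegral_mkcond.
apply: (@Rintegral_limit_eq0 R alpha (fun n x => d x * e n x) _
  (fun x => `|d x|) a0).
- by move=> n; have [[]] := ze n.
- apply: (measurable_restrictT d _).1; first exact: measurable_itv.
  exact: measurable_funTS.
- exact: gdom_norm.
- move=> n x; rewrite normrM ler_piMr// ger0_norm.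
    by have /andP[] : 0 <= e n x <= 1 by apply: step_bounded; rewrite sin_geN1 sin_le1.
  by have /andP[] : 0 <= e n x <= 1 by apply: step_bounded; rewrite sin_geN1 sin_le1.
(* The endpoint is a genuine exception: there [e n] is (1 - 2^-N)^(2^N), which tends to 1/e. *)
- exists [set a]; split; [exact: measurable_set1|exact: lebesgue_measure_set1|].
  move=> x /=; apply: contra_notP => /eqP xa.
  have : d x * e n x @[n --> \oo] --> d x * ((x - a < 0)%R%:R : R).
    by apply: cvgMr; apply: step_sin_cvg; rewrite subr_eq0.
  congr (_ --> _); rewrite patchE mem_setE/= in_itv/= subr_lt0 lt_neqAle xa/=.
  by case: ifP => _; rewrite ?mulr1 ?mulr0.
- move=> n; have [_ /(_ 0 0)] := ze n.
  by under eq_Rintegral do rewrite mul0r addr0 cos0 mulr1.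
Qed.

Lemma laplace_eq0_ae alpha d : 0 < alpha -> gdom alpha d ->
  (forall u, \int[mu]_x (d x * expR (u * x)) = 0) ->
  {ae mu, forall x, d x = 0}.
Proof.
move=> a0 dd d0; have id := gdom_integrable a0 dd.
have zd := moments_eq0_trig_null a0 dd (laplace_eq0_moments a0 dd d0).
have locd : locally_integrable [set: R] d.
  by apply: open_integrable_locally => //; exact: openT.
have intd y : mu.-integrable `]-oo, y] (EFin \o d) by exact: integrableS id.
(* By Lebesgue differentiation d is almost everywhere the derivative of its integral over
   half-lines, which is identically 0. *)
have := FTC1Ny intd locd.
apply: filterS; first exact: (ae_filter_ringOfSetsType mu).
move=> x [_ <-]; rewrite (_ : (fun _ => _) = cst 0) ?derive1_cst//.
by apply/funext => y; rewrite (trig_null_ray y a0 zd).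
Qed.

End StepApproximation.

(** * Hardy's uncertainty principle *)

Section Hardy.
Context {R : realType}.
Local Notation C := R[i].
Local Notation mu := (@lebesgue_measure R).

Lemma gdom_gauss (alpha : R) : gdom alpha (fun x => expR (- (alpha * x ^+ 2))).
Proof.
split; last first.
  by exists 1, 0 => x; rewrite mul0r sub0r mul1r ger0_norm ?expR_ge0.
apply: measurableT_comp => //; apply: measurable_funN.
by apply: measurable_funM => //; exact: measurable_funX.
Qed.

Lemma cexp_sqr (A u v : R) :
  normc (cexp (0 * Complex u v + (- A)%:C%C * Complex u v ^+ 2)) =
  expR (- (A * u ^+ 2)) * expR (A * v ^+ 2).
Proof.
rewrite normc_cexp -expRD; congr expR.
by rewrite /=; ring.
Qed.

(** The decay of h bounds the transform by a multiple of exp(A u^2), which the factor exp(- A z^2)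
    cancels up to exp(A v^2). On the imaginary axis the decay of the transform cancels that factor
    too. *)
Lemma hardy_const (h : R -> C) (alpha gamma C1 C2 : R) :
  0 < alpha -> 1 / (4 * alpha) <= gamma -> 0 <= C1 -> 0 <= C2 -> cdom alpha h ->
  (forall x, normc (h x) <= C1 * expR (- (alpha * x ^+ 2))) ->
  (forall v, normc (laplace h (Complex 0 v)) <= C2 * expR (- (gamma * v ^+ 2))) ->
  exists c : C, (forall z, laplace h z = c * cexp ((1 / (4 * alpha))%:C%C * z ^+ 2)) /\
    (1 / (4 * alpha) < gamma -> c = 0).
Proof.
move=> a0; set A := 1 / (4 * alpha) => Ag C10 C20 dh hC1 hC2.
have A0 : 0 <= A by rewrite divr_ge0// mulr_ge0// ltW.
have [kap kap0 gaussE] := Rintegral_gaussian a0.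
pose E z := cexp (0 * z + (- A)%:C%C * z ^+ 2).
pose H z := laplace h z * E z.
have TH z : taylor2 H z.
  by apply: taylor2M; [exact: (laplace_taylor2 _ a0)|exact: taylor2_cexp].
have boundL u v : normc (laplace h (Complex u v)) <=
    2 * (C1 * kap) * expR (A * u ^+ 2).
  have dc : cdom alpha (fun x => h x * cexp (x%:C%C * Complex u v)).
    by apply: cdomM => //; exact: cdom0_cexp.
  have gg : gdom alpha (fun x => C1 * expR (- (alpha * x ^+ 2)) * expR (u * x)).
    by apply: gdomMr; [apply: gdomZ; exact: gdom_gauss|exact: gdom0_expR].
  apply: le_trans (normc_cintegral_le a0 dc gg _) _.
    move=> x; rewrite normcM normc_cexp complex_ReM/= mul0r subr0 [x * u]mulrC.
    by rewrite ler_wpM2r ?expR_ge0.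
  have -> : (fun x => C1 * expR (- (alpha * x ^+ 2)) * expR (u * x)) =
      (fun x => C1 * expR (x * u - alpha * x ^+ 2)).
    by apply/funext => x; rewrite -mulrA -expRD; congr (_ * expR _); ring.
  rewrite RintegralZl//; last exact: integrable_gaussian.
  rewrite gaussE le_eqVlt; apply/orP; left; apply/eqP.
  have -> : u ^+ 2 / (4 * alpha) = A * u ^+ 2 by rewrite /A mulrC mul1r.
  by ring.
pose M := 2 * (C1 * kap) + C2.
have M0 : 0 <= M by rewrite addr_ge0 ?mulr_ge0// ltW.
have growth u v : normc (H (Complex u v)) <= M * expR (A * v ^+ 2).
  rewrite normcM cexp_sqr mulrA ler_wpM2r ?expR_ge0//.
  apply: le_trans (ler_wpM2r (expR_ge0 _) (boundL u v)) _.
  by rewrite -[leLHS]mulrA -expRD subrr expR0 mulr1 lerDl.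
have axisE v : normc (H (Complex 0 v)) <= C2 * expR (- ((gamma - A) * v ^+ 2)).
  rewrite normcM cexp_sqr expr0n mulr0 oppr0 expR0 mul1r.
  apply: le_trans (ler_wpM2r (expR_ge0 _) (hC2 v)) _.
  by rewrite -[leLHS]mulrA -expRD mulrBl opprB [_ - _]addrC.
have axis v : normc (H (Complex 0 v)) <= M.
  apply: le_trans (axisE v) _; apply: (@le_trans _ _ C2).
    rewrite ler_piMr// -expR0 ler_expR oppr_le0 mulr_ge0 ?sqr_ge0//.
    by rewrite subr_ge0.
  by rewrite lerDr !mulr_ge0// ltW.
have Hcst := liouville TH (phragmen_lindelof_plane A0 M0 TH growth axis).
exists (H 0); split=> [z|gA].
  rewrite -(Hcst z) /H /E -mulrA -cexpD mul0r add0r.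
  by rewrite -mulrDl -rmorphD/= addNr mul0r cexp0 mulr1.
apply/eqP; apply/negP => /negP H0.
have n0 : 0 < normc (H 0).
  by rewrite lt_def normc_ge0 andbT; apply: contra H0 => /eqP/eq0_normc ->.
have g0 : 0 < gamma - A by rewrite subr_gt0.
(* At v^2 = w the inequality 1 + x <= exp x turns the axis bound into |H 0| + C2 <= C2. *)
pose w := C2 / (normc (H 0) * (gamma - A)).
have w0 : 0 <= w by rewrite divr_ge0 ?mulr_ge0// ltW.
have := axisE (Num.sqrt w); rewrite Hcst sqr_sqrtr//.
rewrite expRN ler_pdivlMr ?expR_gt0//.
have h1 := expR_ge1Dx ((gamma - A) * w).
move=> /(le_trans (ler_wpM2l (ltW n0) h1)).
have -> : normc (H 0) * (1 + (gamma - A) * w) = normc (H 0) + C2.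
  by rewrite /w; field; rewrite !gt_eqF.
by rewrite gerDr leNgt n0.
Qed.

(** Real arguments u suffice for uniqueness. There the kernel is real, so the real and imaginary
    parts of h are each compared with a real multiple of the Gaussian. *)
Lemma hardy (h : R -> C) (alpha gamma C1 C2 : R) :
  0 < alpha -> 1 / (4 * alpha) <= gamma -> 0 <= C1 -> 0 <= C2 -> cdom alpha h ->
  (forall x, normc (h x) <= C1 * expR (- (alpha * x ^+ 2))) ->
  (forall v, normc (laplace h (Complex 0 v)) <= C2 * expR (- (gamma * v ^+ 2))) ->
  exists c : C, {ae mu, forall x, h x = c * (expR (- (alpha * x ^+ 2)))%:C%C} /\
    (1 / (4 * alpha) < gamma -> c = 0).
Proof.
move=> a0 Ag C10 C20 dh hC1 hC2.
have [c [cE c0]] := hardy_const a0 Ag C10 C20 dh hC1 hC2.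
have [kap kap0 gaussE] := Rintegral_gaussian a0.
exists (c * kap^-1%:C%C); split; last by move=> /c0 ->; rewrite mul0r.
have key (p : R) (d : R -> R) : gdom alpha d ->
    (forall u, \int[mu]_x (d x * expR (u * x)) = p * expR (u ^+ 2 / (4 * alpha))) ->
    {ae mu, forall x, d x - p / kap * expR (- (alpha * x ^+ 2)) = 0}.
  move=> gd dE; apply: (laplace_eq0_ae a0).
    by apply: gdomB => //; apply: gdomZ; exact: gdom_gauss.
  move=> u.
  have E x : (d x - p / kap * expR (- (alpha * x ^+ 2))) * expR (u * x) =
      d x * expR (u * x) - p / kap * (expR (- (alpha * x ^+ 2)) * expR (u * x)).
    by ring.
  under eq_Rintegral do rewrite E.
  have gu : gdom alpha (fun x => d x * expR (u * x)).
    by apply: gdomMr => //; exact: gdom0_expR.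
  have ge : gdom alpha (fun x => expR (- (alpha * x ^+ 2)) * expR (u * x)).
    by apply: gdomMr; [exact: gdom_gauss|exact: gdom0_expR].
  rewrite RintegralB//;
    [|exact: (gdom_integrable a0)|by apply: (gdom_integrable a0); exact: gdomZ].
  rewrite dE RintegralZl//; last exact: (gdom_integrable a0).
  have -> : \int[mu]_x (expR (- (alpha * x ^+ 2)) * expR (u * x)) =
      kap * expR (u ^+ 2 / (4 * alpha)).
    rewrite -gaussE; apply: eq_Rintegral => x _.
    by rewrite -expRD; congr expR; ring.
  by rewrite mulrA divfK ?subrr// gt_eqF.
have lapE (u : R) : laplace h u%:C%C = c * (expR (u ^+ 2 / (4 * alpha)))%:C%C.
  rewrite cE -rmorphXn -rmorphM/= cexpR; congr (_ * (expR _)%:C%C).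
  by rewrite mulrC mul1r.
have reE (u : R) : \int[mu]_x (complex.Re (h x) * expR (u * x)) =
    complex.Re c * expR (u ^+ 2 / (4 * alpha)).
  have -> : complex.Re c * expR (u ^+ 2 / (4 * alpha)) = complex.Re (laplace h u%:C%C).
    by rewrite lapE complex_ReM/= mulr0 subr0.
  apply: eq_Rintegral => x _; rewrite -rmorphM cexpR complex_ReM/= mulr0 subr0.
  by rewrite mulrC [x * u]mulrC mulrC.
have imE (u : R) : \int[mu]_x (complex.Im (h x) * expR (u * x)) =
    complex.Im c * expR (u ^+ 2 / (4 * alpha)).
  have -> : complex.Im c * expR (u ^+ 2 / (4 * alpha)) = complex.Im (laplace h u%:C%C).
    by rewrite lapE complex_ImM/= mulr0 add0r.
  apply: eq_Rintegral => x _; rewrite -rmorphM cexpR complex_ImM/= mulr0 add0r.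
  by rewrite mulrC [x * u]mulrC mulrC.
have := key _ _ dh.2 imE; have := key _ _ dh.1 reE.
apply: filterS2; first exact: (ae_filter_ringOfSetsType mu).
move=> x /eqP; rewrite subr_eq0 => /eqP hr /eqP; rewrite subr_eq0 => /eqP hi.
apply/eqP; rewrite eq_complex !(complex_ReM, complex_ImM)/=.
rewrite !(mulr0, mul0r, subr0, add0r, addr0).
by rewrite hr hi !eqxx.
Qed.

(** A nonzero value would persist on a ball, which has positive measure. *)
Lemma continuous_ae0 (w : R -> R) : continuous w ->
  {ae mu, forall x, w x = 0} -> forall x, w x = 0.
Proof.
move=> cw [N [mN N0 wN]] x; apply/eqP; apply/negP => /negP wx.
have : \forall y \near x, 0 < `|w y|.
  have cwx : `|w y| @[y --> x] --> `|w x| by apply: cvg_norm; exact: cw.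
  by apply: (cvgr_gt _ cwx); rewrite normr_gt0.
move=> /nbhs_ballP[e /= e0 ew].
have : (mu (ball x e) <= mu N)%E.
  apply: le_measure; rewrite ?inE//; first exact: measurable_ball.
  move=> y /ew; rewrite normr_gt0 => wy; apply: wN => /= wy0.
  by rewrite wy0 eqxx in wy.
rewrite [X in (_ <= X)%E]N0 lebesgue_measure_ball ?(ltW e0)// lee_fin.
by rewrite leNgt mulrn_wgt0.
Qed.

Lemma cexp_i (t : R) : cexp ('i * t%:C%C) = Complex (cos t) (sin t).
Proof.
by rewrite -complexiE /cexp/= !mul0r !mul1r subrr add0r expR0 !mul1r.
Qed.

Lemma ccontinuous_ReIm (f : R -> C) : ccontinuous f ->
  continuous (fun x => complex.Re (f x)) /\ continuous (fun x => complex.Im (f x)).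
Proof.
move=> cf.
have H (P : C -> R) : (forall z, `|P z| <= normc z) ->
    (forall z w, P (z - w) = P z - P w) -> continuous (fun x => P (f x)).
  move=> Pn PB x; apply/cvgrPdist_lt => /= e e0.
  have /cvgrPdist_lt/(_ e%:C%C) := cf x; rewrite ltcR => /(_ e0).
  apply: filterS => y; rewrite -PB => fxy; apply: le_lt_trans (Pn _) _.
  by rewrite -ltcR.
split; apply: H.
- exact: Re_le_normc.
- by move=> [a b] [c d].
- exact: Im_le_normc.
- by move=> [a b] [c d].
Qed.

End Hardy.

(** * The linear canonical transform *)

Section LinearCanonicalTransform.
Context {R : realType}.
Local Notation C := R[i].
Local Notation mu := (@lebesgue_measure R).

Lemma normc_le_real (z : C) (t : R) : `|z| <= t%:C%C -> normc z <= t.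
Proof. by rewrite -[`|z|]/((normc z)%:C)%C lecR. Qed.

Lemma cdom_of_decay (f : R -> C) (alpha B : R) : cmeasurable f ->
  (forall x, normc (f x) <= B * expR (- (alpha * x ^+ 2))) -> cdom alpha f.
Proof.
move=> [mr mi] fB; split; split => //; exists B, 0 => x; rewrite mul0r sub0r.
  exact: le_trans (Re_le_normc _) (fB x).
exact: le_trans (Im_le_normc _) (fB x).
Qed.

Lemma cdom0_chirp (k : R) : cdom 0 (fun x => cexp ('i * (k * x ^+ 2)%:C%C)).
Proof.
have mk : measurable_fun setT (fun x : R => k * x ^+ 2).
  by apply: measurable_funM => //; exact: measurable_funX.
split; under eq_fun do rewrite cexp_i/=; apply: (@gdom0_bounded _ _ 1).
- apply: (measurableT_comp _ mk).
  by apply: continuous_measurable_fun; exact: continuous_cos.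
- by move=> x; rewrite ler_norml cos_geN1 cos_le1.
- apply: (measurableT_comp _ mk).
  by apply: continuous_measurable_fun; exact: continuous_sin.
- by move=> x; rewrite ler_norml sin_geN1 sin_le1.
Qed.

Lemma normc_cexp_i (t : R) : normc (cexp ('i * t%:C%C)) = 1.
Proof. by rewrite cexp_i /= cos2Dsin2 sqrtr1. Qed.

(** The exponent splits into a chirp in x, the product of x with a purely imaginary number, and a
    term in xi alone that leaves the integral. *)
Lemma LCT_laplace (S : 'M[R]_2) (f : R -> C) (alpha xi : R) :
  S 0 1 != 0 -> 0 < alpha -> cdom alpha f ->
  LCT S f xi = (sqrtC ('i * (S 0 1)%:C%C))^-1 *
    (laplace (fun x => f x * cexp ('i * (pi * S 0 0 / S 0 1 * x ^+ 2)%:C%C))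
       (Complex 0 (- (2 * pi * xi / S 0 1))) *
     cexp ('i * (pi * S 1 1 / S 0 1 * xi ^+ 2)%:C%C)).
Proof.
move=> b0 a0 df; rewrite /LCT; congr (_ * _).
rewrite /laplace -(cintegralZr _ a0); last first.
  by apply: cdomM; [apply: cdomM => //; exact: cdom0_chirp|exact: cdom0_cexp].
congr cintegral; apply/funext => x; rewrite -!mulrA -!cexpD; congr (_ * cexp _).
rewrite -complexiE; apply/eqP; rewrite eq_complex/=.
by move: (pi : R) => p; apply/andP; split; apply/eqP; field.
Qed.

Lemma hardy_LCT (S : 'M[R]_2) (f : R -> C) (C1 C2 alpha beta : R) :
  S 0 1 != 0 -> cmeasurable f -> 0 <= C1 -> 0 <= C2 -> 0 < alpha ->
  (forall x, normc (f x) <= C1 * expR (- (alpha * x ^+ 2))) ->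
  (forall xi, normc (LCT S f xi) <= C2 * expR (- (beta * xi ^+ 2))) ->
  pi ^+ 2 / S 0 1 ^+ 2 <= alpha * beta ->
  exists c : C,
    {ae mu, forall x, f x = c *
      cexp (- (alpha%:C%C + 'i * (pi * S 0 0 / S 0 1)%:C%C) * (x ^+ 2)%:C%C)} /\
    (pi ^+ 2 / S 0 1 ^+ 2 < alpha * beta -> c = 0).
Proof.
move=> b0 mf C10 C20 a0 fC1 LC2 ab.
have df := cdom_of_decay mf fC1.
have b2 : 0 < S 0 1 ^+ 2 by rewrite exprn_even_gt0.
have p0 : (pi : R) != 0 by rewrite gt_eqF// pi_gt0.
set s := sqrtC ('i * (S 0 1)%:C%C).
have s0 : 0 < normc s.
  rewrite lt_def normc_ge0 andbT; apply/eqP => /eq0_normc /eqP.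
  rewrite sqrtC_eq0 mulf_eq0 (negPf (neq0Ci _))/= => /eqP/complexI/eqP.
  by rewrite (negPf b0).
pose k := pi * S 0 0 / S 0 1.
pose h x := f x * cexp ('i * (k * x ^+ 2)%:C%C).
(* From v = - 2 pi xi / b, so that beta xi^2 = gamma v^2. The threshold gamma >= 1 / (4 alpha) is
   then alpha beta >= pi^2 / b^2. *)
pose gamma := beta * S 0 1 ^+ 2 / (4 * pi ^+ 2).
have dh : cdom alpha h by apply: cdomM => //; exact: cdom0_chirp.
have hC1 x : normc (h x) <= C1 * expR (- (alpha * x ^+ 2)).
  by rewrite normcM normc_cexp_i mulr1.
have hC2 v : normc (laplace h (Complex 0 v)) <=
    normc s * C2 * expR (- (gamma * v ^+ 2)).
  pose xi := - (S 0 1 * v / (2 * pi)).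
  have := LC2 xi; rewrite (LCT_laplace _ b0 a0 df) !normcM normc_cexp_i mulr1.
  rewrite normcV -/s ler_pdivrMl// -[X in _ -> _ <= X]mulrA.
  have -> : - (2 * pi * xi / S 0 1) = v.
    by rewrite /xi; move: (pi : R) p0 => p p0; field; rewrite ?p0 ?b0.
  have -> // : beta * xi ^+ 2 = gamma * v ^+ 2.
  by rewrite /xi /gamma; move: (pi : R) p0 => p p0; field; rewrite ?p0.
have gE : gamma = (alpha * beta) * S 0 1 ^+ 2 / (4 * alpha * pi ^+ 2).
  by rewrite /gamma; move: (pi : R) p0 => p p0; field; rewrite ?p0 ?gt_eqF.
have AE : 1 / (4 * alpha) =
    pi ^+ 2 / S 0 1 ^+ 2 * S 0 1 ^+ 2 / (4 * alpha * pi ^+ 2).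
  by move: (pi : R) p0 => p p0; field; rewrite ?p0 ?b0 ?gt_eqF.
have pos : 0 < (4 * alpha * pi ^+ 2)^-1.
  by rewrite invr_gt0 !mulr_gt0 ?pi_gt0.
have [||c [hc c0]] := hardy a0 _ C10 _ dh hC1 hC2.
- by rewrite gE AE ler_pM2r// ler_pM2r.
- by rewrite mulr_ge0 ?normc_ge0.
exists c; split; last by move=> ltab; apply: c0; rewrite gE AE ltr_pM2r// ltr_pM2r.
move: hc; apply: filterS; first exact: (ae_filter_ringOfSetsType mu).
move=> x hx; have -> : f x = h x * cexp ('i * (- (k * x ^+ 2))%:C%C).
  by rewrite /h -mulrA -cexpD -mulrDr -rmorphD/= subrr mulr0 cexp0 mulr1.
rewrite hx -mulrA -cexpR -cexpD; congr (_ * cexp _).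
rewrite -complexiE; apply/eqP; rewrite eq_complex/=.
by apply/andP; split; apply/eqP; rewrite /k; ring.
Qed.

(** Continuity of the chirped Gaussian upgrades the almost everywhere identity to every point when f
    is continuous. *)
Lemma continuous_ReIm_gaussian (c : C) (alpha k : R) :
  let g := fun x : R => c * cexp (- (alpha%:C%C + 'i * k%:C%C) * (x ^+ 2)%:C%C) in
  continuous (fun x => complex.Re (g x)) /\ continuous (fun x => complex.Im (g x)).
Proof.
move=> g.
have gE x : g x = c * Complex (expR (- alpha * x ^+ 2) * cos (- k * x ^+ 2))
                              (expR (- alpha * x ^+ 2) * sin (- k * x ^+ 2)).
  rewrite /g; congr (_ * _); rewrite -complexiE /cexp/=.
  have -> : - (alpha + (0 * k - 1 * 0)) * x ^+ 2 - - (0 + (0 * 0 + 1 * k)) * 0 =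
    - alpha * x ^+ 2 by ring.
  by have -> : - (alpha + (0 * k - 1 * 0)) * 0 + - (0 + (0 * 0 + 1 * k)) * x ^+ 2 =
    - k * x ^+ 2 by ring.
have cq (t : R) : continuous (fun x : R => t * x ^+ 2).
  by move=> x; apply: cvgMr; exact: exprn_continuous.
have cc : continuous (fun x : R => expR (- alpha * x ^+ 2) * cos (- k * x ^+ 2)).
  move=> x; apply: cvgM.
    exact: (cvg_comp _ _ (cq (- alpha) x) (@continuous_expR R _)).
  exact: (cvg_comp _ _ (cq (- k) x) (@continuous_cos R _)).
have cs : continuous (fun x : R => expR (- alpha * x ^+ 2) * sin (- k * x ^+ 2)).
  move=> x; apply: cvgM.
    exact: (cvg_comp _ _ (cq (- alpha) x) (@continuous_expR R _)).
  exact: (cvg_comp _ _ (cq (- k) x) (@continuous_sin R _)).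
split.
  rewrite (_ : (fun x => complex.Re (g x)) = fun x =>
      complex.Re c * (expR (- alpha * x ^+ 2) * cos (- k * x ^+ 2)) -
      complex.Im c * (expR (- alpha * x ^+ 2) * sin (- k * x ^+ 2))).
    by move=> x; apply: cvgB; apply: cvgMr; [exact: cc|exact: cs].
  by apply/funext => x; rewrite gE complex_ReM.
rewrite (_ : (fun x => complex.Im (g x)) = fun x =>
    complex.Re c * (expR (- alpha * x ^+ 2) * sin (- k * x ^+ 2)) +
    complex.Im c * (expR (- alpha * x ^+ 2) * cos (- k * x ^+ 2))).
  by move=> x; apply: cvgD; apply: cvgMr; [exact: cs|exact: cc].
by apply/funext => x; rewrite gE complex_ImM.
Qed.

Lemma ccontinuous_ae_eq (f g : R -> C) : ccontinuous f ->
  continuous (fun x => complex.Re (g x)) -> continuous (fun x => complex.Im (g x)) ->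
  {ae mu, forall x, f x = g x} -> forall x, f x = g x.
Proof.
move=> /ccontinuous_ReIm[fr fi] gr gi fg x.
have sub (P : C -> R) : continuous (fun x => P (f x)) ->
    continuous (fun x => P (g x)) -> P (f x) = P (g x).
  move=> Pf Pg; apply/eqP; rewrite -subr_eq0; apply/eqP.
  apply: (@continuous_ae0 R (fun y => P (f y) - P (g y))).
    by move=> y; apply: cvgB; [exact: Pf|exact: Pg].
  move: fg; apply: filterS; first exact: (ae_filter_ringOfSetsType mu).
  by move=> y ->; rewrite subrr.
by apply/eqP; rewrite eq_complex (sub _ fr gr) (sub _ fi gi) !eqxx.
Qed.

End LinearCanonicalTransform.

Theorem theorem24 (R : realType) (S : 'M[R]_2) (detS : \det S = 1)
  (b_neq0 : S 0 1 != 0) (f : R -> R[i]) (mf : cmeasurable f)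
  (C1 C2 alpha beta : R)
  (C1_gt0 : 0 < C1) (C2_gt0 : 0 < C2)
  (alpha_gt0 : 0 < alpha) (beta_gt0 : 0 < beta)
  (f_decay : forall x : R, `|f x| <= (C1 * expR (- (alpha * x ^+ 2)))%:C%C)
  (LCT_decay : forall xi : R,
     `|LCT S f xi| <= (C2 * expR (- (beta * xi ^+ 2)))%:C%C) :
  (alpha * beta = pi ^+ 2 / S 0 1 ^+ 2 ->
    exists A : R[i],
      let g := fun x : R =>
        A * cexp (- (alpha%:C%C + 'i * (pi * S 0 0 / S 0 1)%:C%C)
                  * (x ^+ 2)%:C%C) in
      {ae @lebesgue_measure R, forall x, f x = g x} /\
      (ccontinuous f -> forall x, f x = g x)) /\
  (alpha * beta > pi ^+ 2 / S 0 1 ^+ 2 ->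
    {ae @lebesgue_measure R, forall x, f x = 0} /\
    (ccontinuous f -> forall x, f x = 0)).
Proof.
have fC1 x := normc_le_real (f_decay x).
have LC2 xi := normc_le_real (LCT_decay xi).
have H := hardy_LCT b_neq0 mf (ltW C1_gt0) (ltW C2_gt0) alpha_gt0 fC1 LC2.
split=> ab.
  have [c [fc _]] := H (eq_ind_r (fun t => _ <= t) (lexx _) ab).
  exists c => /=; split=> // cf.
  have [gr gi] := continuous_ReIm_gaussian c alpha (pi * S 0 0 / S 0 1).
  exact: ccontinuous_ae_eq.
have [c [fc c0]] := H (ltW ab).
have {}fc : {ae @lebesgue_measure R, forall x, f x = 0}.
  move: fc; apply: filterS; first exact: (ae_filter_ringOfSetsType (@lebesgue_measure R)).
  by move=> x ->; rewrite c0// mul0r.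
split=> // cf; apply: (ccontinuous_ae_eq cf) => // x; exact: cvg_cst.
Qed.
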